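(* Let $G$ be a compact Hausdorff topological group with normalized Haar measure $\mu$. Let $K\subseteq G$ be a closed subgroup, let $V$ be the left coset space $\{gK: g\in G\}$ (with the induced $G$-invariant probability measure, also denoted $\mu$), and let $\mathcal{H}=L_2(V,\mu)$. Let $d$ be the degree of the smallest non-trivial irreducible representation of $G$ which appears in the induced action of $G$ on $\mathcal{H}$ (assuming there is one). Then every $G$-invariant self-adjoint Hilbert–Schmidt kernel operator $H$ on $V\times V$ with $\|H\|_2\le 1$ satisfies $\|H-p\|_\square\le 1/\sqrt{d}$, where $p$ is the constant function on $V\times V$ with value $\int_{V\times V}H(x,y)\,dx\,dy$.
   Context: A Hilbert–Schmidt kernel operator is a complex-valued function $H\in L_2(V\times V,\mu\times\mu)$ (up to a.e. equality), acting on $L_2(V,\mu)$ by $(Hf)(x)=\int H(x,y)f(y)\,d\mu(y)$; it is self-adjoint if $H(x,y)=\overline{H(y,x)}$ a.e., and $\|H\|_2$ is its $L_2(V\times V)$ norm. The left action of $G$ on $V$ induces a unitary action on $L_2(V,\mu)$; $H$ is $G$-invariant if the operator $H$ commutes with this action, i.e. for every $g\in G$, $H(gx,gy)=H(x,y)$ for a.e. $(x,y)$. The cut norm is $\|H\|_\square=\sup\bigl|\iint\overline{f(x)}H(x,y)g(y)\,d\mu(x)\,d\mu(y)\bigr|$ over measurable $f,g:V\to\mathbb{C}$ with $\|f\|_\infty,\|g\|_\infty\le 1$. *)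

(* Defs.v *)
From HB Require Import structures.
From mathcomp Require Import all_boot all_order all_algebra generic_quotient.
From mathcomp Require Import all_classical all_reals all_analysis.
From mathcomp.real_closed Require Import complex.

Set Implicit Arguments.
Unset Strict Implicit.
Unset Printing Implicit Defensive.
Import Order.TTheory GRing.Theory Num.Theory.
Import numFieldNormedType.Exports.
Local Open Scope classical_set_scope.
Local Open Scope ring_scope.

HB.mixin Record isTopologicalGroup G & PointedTopological G & Group G := {
  mulg_continuous : continuous (fun x : G * G => (x.1 * x.2)%g) ;
  invg_continuous : continuous (fun x : G => x^-1%g)
}.

(* The distinguished point carries no information: it is required only because
   measurableType, and hence g_sigma_algebraType, asks for a pointed type. *)
#[short(type="topologicalGroupType")]
HB.structure Definition TopologicalGroup :=
  {G of PointedTopological G & Group G & isTopologicalGroup G}.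

Notation borel T := (g_sigma_algebraType (@open T)).

Section Haar.
Context {R : realType} {G : topologicalGroupType}.
Implicit Type mu : probability (borel G) R.

Definition left_invariant mu :=
  forall (g : G) (A : set (borel G)), measurable A ->
    mu [set (g * x)%g | x in A] = mu A.

Definition outer_regular mu :=
  forall A : set (borel G), measurable A ->
    mu A = ereal_inf [set mu U | U in [set U : set G | open U /\ A `<=` U]].

Definition inner_regular mu :=
  forall U : set G, open U ->
    mu U = ereal_sup [set mu C | C in [set C : set G | compact C /\ C `<=` U]].

(* The Borel sigma-algebra of a non-metrizable G need not be generated by its Baire
   sets, so regularity is part of the definition of Haar measure; compact sets
   are Borel because G is assumed Hausdorff wherever this is used. *)
Definition normalized_haar mu :=
  [/\ left_invariant mu, outer_regular mu & inner_regular mu].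

End Haar.

Section CosetSpace.
Context {G : topologicalGroupType} (K : groupClosed G).
Local Open Scope quotient_scope.

(* x K = y K *)
Definition same_coset : rel G := fun x y => (x^-1 * y)%g \in K.

Lemma same_coset_equiv : equiv_class_of same_coset.
Proof.
split=> [x|x y|y x z]; rewrite /same_coset.
- by rewrite mulVg gpred1.
- by rewrite -gpredV invgM invgK.
- move=> xy yz; have -> : (x^-1 * z = (x^-1 * y) * (y^-1 * z))%g.
    by rewrite mulgA mulgK.
  exact: gpredM.
Qed.

Canonical same_coset_equiv_rel := EquivRelPack same_coset_equiv.

Definition left_cosets := quotient_topology {eq_quot same_coset}.
HB.instance Definition _ := PointedTopological.on left_cosets.
HB.instance Definition _ := Quotient.on left_cosets.

Definition coset_proj (x : borel G) : borel left_cosets := \pi_left_cosets x.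

Lemma measurable_coset_proj : measurable_fun [set: borel G] coset_proj.
Proof.
apply: (@measurability _ _ (borel G) (borel left_cosets) setT coset_proj
          (@open left_cosets)) => //.
by move=> _ [U oU <-]; rewrite setTI; apply: sub_sigma_algebra; exact: oU.
Qed.

HB.instance Definition _ :=
  isMeasurableFun.Build _ _ _ _ coset_proj measurable_coset_proj.

Definition coset_act (g : G) (x : left_cosets) : left_cosets :=
  \pi_left_cosets (g * repr x)%g.

Lemma coset_act_pi (g x : G) :
  coset_act g (\pi_left_cosets x) = \pi_left_cosets (g * x)%g.
Proof.
apply/eqmodP; rewrite /= /same_coset invgM -mulgA mulKg.
by have /eqmodP : repr (\pi_left_cosets x) = x %[mod left_cosets] by rewrite reprK.
Qed.

Definition coset_measure {R : realType} (mu : probability (borel G) R) :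
    probability (borel left_cosets) R :=
  distribution mu coset_proj.

End CosetSpace.

Section ComplexL2.
Context {d : measure_display} {T : measurableType d} {R : realType}.
Implicit Types (nu : {measure set T -> \bar R}) (f : T -> R[i]).

Definition cmeasurable f :=
  measurable_fun [set: T] (fun x => complex.Re (f x)) /\
  measurable_fun [set: T] (fun x => complex.Im (f x)).

Definition cLnorm nu (p : \bar R) f : \bar R :=
  ('N[nu]_p[EFin \o (fun x => Normc.normc (f x))])%E.

Definition cL2 nu f := cmeasurable f /\ (cLnorm nu 2%:E f < +oo)%E.

Definition cintegral nu f : R[i] :=
  Complex (\int[nu]_x complex.Re (f x))%R (\int[nu]_x complex.Im (f x))%R.

End ComplexL2.

Section Kernels.
Context {d : measure_display} {T : measurableType d} {R : realType}.
Variable nu : probability T R.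
Local Notation nu2 := (nu \x nu)%E.
Implicit Type H : T * T -> R[i].

Definition hilbert_schmidt_kernel H := cL2 nu2 H.

Definition self_adjoint H :=
  {ae nu2, forall z, H z = conjc (H (z.2, z.1))}.

Definition cut_norm H : \bar R :=
  ereal_sup [set r | exists f g : T -> R[i],
    [/\ cmeasurable f, (cLnorm nu +oo f <= 1)%E,
        cmeasurable g, (cLnorm nu +oo g <= 1)%E &
        r = (Normc.normc
          (cintegral nu2 (fun z => conjc (f z.1) * H z * g z.2)))%:E]].

Definition mean H : R[i] := cintegral nu2 H.

End Kernels.

Section Representations.
Context {R : realType} {G : topologicalGroupType}.
Variables (mu : probability (borel G) R) (K : groupClosed G).
Local Notation V := (borel (left_cosets K)).
Local Notation nu := (coset_measure K mu).

(* The operator with kernel H commutes with translation by every g, expressed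
   on kernels. *)
Definition invariant_kernel (H : V * V -> R[i]) :=
  forall g : G, {ae (nu \x nu)%E, forall z,
    H (coset_act g z.1, coset_act g z.2) = H z}.

Section Degree.
Variable n : nat.
Implicit Type rho : G -> 'M[R[i]]_n.

Definition representation rho :=
  [/\ rho 1%g = 1%:M,
      forall g h, rho (g * h)%g = rho g *m rho h &
      forall i j, continuous (fun g => complex.Re (rho g i j)) /\
                  continuous (fun g => complex.Im (rho g i j))].

Definition irreducible rho :=
  (0 < n)%N /\
  forall W : {vspace 'cV[R[i]]_n},
    (forall g v, v \in W -> rho g *m v \in W) -> W = 0%VS \/ W = fullv.

(* An irreducible rho is equivalent to the trivial (one-dimensional)
   representation exactly when all rho g are the identity. *)
Definition nontrivial rho := exists g, rho g <> 1%:M.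

(* There is an injective intertwiner from rho into the translation action
   (g . f)(x) = f(g^-1 x) on L_2(V, nu); elements of L_2 are represented by
   functions, so linearity, equivariance and injectivity hold modulo a.e.
   equality. *)
Definition appears_in_L2 rho :=
  exists phi : 'cV[R[i]]_n -> V -> R[i],
  [/\ forall v, cL2 nu (phi v),
      forall a u v,
        {ae nu, forall x, phi (a *: u + v) x = a * phi u x + phi v x},
      forall g v,
        {ae nu, forall x, phi (rho g *m v) x = phi v (coset_act g^-1%g x)} &
      forall v, {ae nu, forall x, phi v x = 0} -> v = 0].

Definition nontrivial_irreducible_degree :=
  exists rho, [/\ representation rho, irreducible rho, nontrivial rho &
                  appears_in_L2 rho].

End Degree.

Definition smallest_nontrivial_degree (n : nat) :=
  nontrivial_irreducible_degree n /\
  forall m, nontrivial_irreducible_degree m -> (n <= m)%N.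

End Representations.

(* Main.v *)
(* Let K = H - p. It suffices to bound the operator norm of K. Let s be the square of
   this norm. K is a G-invariant self-adjoint Hilbert-Schmidt operator which kills the
   constants, so for s > 0 the space E = {f | K^2 f = s f} is G-invariant, orthogonal to
   the constants and, by Bessel's inequality for the rows of K, of dimension at most
   ||K||_2^2 / s <= 1 / s. A minimal nonzero invariant subspace of E is an irreducible
   representation, continuous because translation is continuous in L_2, and nontrivial
   because Haar measure is ergodic. Hence d <= 1 / s.

   That E is nonzero is shown without weak compactness. As b_n = s^-n ||K^n v||^2 is
   nonincreasing in n, the vectors s^-n K^(2n) v form a Cauchy sequence; K turns it into
   a sequence converging pointwise, whose limit lies in E. The limit is nonzero for some
   column v of K: otherwise b_n would tend to 0 for all columns, which contradicts
   dominated convergence, since |(K^(n+1) h)(y)|^2 <= ||h||^2 ||K^n v_y||^2 for the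
   column v_y at y.

   The Borel sigma-algebra of G * G may be larger than the product sigma-algebra, so
   Fubini's theorem is not available for functions of y^-1 x; ergodicity and continuity
   of translations are derived from regularity of the measure instead. *)
Require Import Defs.
From HB Require Import structures.
From mathcomp Require Import all_boot all_order all_algebra generic_quotient.
From mathcomp Require Import all_classical all_reals all_analysis.
From mathcomp.real_closed Require Import complex.
From mathcomp Require Import measurable_realfun ess_sup_inf ring lra.
Set Implicit Arguments.
Unset Strict Implicit.
Unset Printing Implicit Defensive.
Import Order.TTheory GRing.Theory Num.Theory.
Import numFieldNormedType.Exports.
Local Open Scope classical_set_scope.
Local Open Scope ring_scope.

(** * Integration of complex-valued functions *)

(** The square of the operator appears because its norm may be attained at the eigenvalue [sqrt s]
    or at [- sqrt s]; squaring merges both into one eigenspace. Elements of L_2 are functions and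
    not classes, so the eigenvalue equation is tested against all square-integrable [h], which suits
    almost everywhere equality as well as limits. For the same reason the kernel is first made
    Hermitian at every point, with square-integrable columns everywhere: then the value at [x] of
    the image of [f] is an inner product with the column at [x], and Cauchy-Schwarz gives pointwise
    bounds. The contradiction with dominated convergence needs vectors that resist decay:
    near-maximizers [h_n] of the norm with relative defect [1 / (2 (n + 1))] keep at least half of
    the largest possible squared norm after [n] applications, by log-convexity of the squared norms
    of the iterates. Ergodicity comes from the inequality between [mu A * mu B] and the measure of
    the part of [A] whose inverses lie in [B], for almost invariant [A]. The cut norm enters only at
    the end: on a probability space a function bounded by 1 has L_2 norm at most 1. *)

Section ComplexNumbers.
Context {R : realType}.
Implicit Types z w : R[i].

(** The squared modulus with values in [R]: L_2 estimates become polynomial inequalities without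
    square roots. *)
Definition normsq z : R := complex.Re z ^+ 2 + complex.Im z ^+ 2.

Lemma ReD z w : complex.Re (z + w) = complex.Re z + complex.Re w.
Proof. by case: z; case: w. Qed.
Lemma ImD z w : complex.Im (z + w) = complex.Im z + complex.Im w.
Proof. by case: z; case: w. Qed.
Lemma ReN z : complex.Re (- z) = - complex.Re z.
Proof. by case: z. Qed.
Lemma ImN z : complex.Im (- z) = - complex.Im z.
Proof. by case: z. Qed.
Lemma ReM z w : complex.Re (z * w) =
  complex.Re z * complex.Re w - complex.Im z * complex.Im w.
Proof. by case: z; case: w. Qed.
Lemma ImM z w : complex.Im (z * w) =
  complex.Re z * complex.Im w + complex.Im z * complex.Re w.
Proof. by case: z; case: w. Qed.
Lemma Re_conjc z : complex.Re (conjc z) = complex.Re z.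
Proof. by case: z. Qed.
Lemma Im_conjc z : complex.Im (conjc z) = - complex.Im z.
Proof. by case: z. Qed.

Definition ReImE := (ReD, ImD, ReN, ImN, ReM, ImM, Re_conjc, Im_conjc).

Lemma complexP z w : complex.Re z = complex.Re w ->
  complex.Im z = complex.Im w -> z = w.
Proof. by case: z => a b; case: w => c d /= -> ->. Qed.

Lemma normsq_ge0 z : 0 <= normsq z.
Proof. by rewrite addr_ge0// sqr_ge0. Qed.

Lemma normsq_eq0 z : normsq z = 0 -> z = 0.
Proof.
move=> /eqP; rewrite paddr_eq0 ?sqr_ge0// !sqrf_eq0 => /andP[/eqP a /eqP b].
exact: complexP.
Qed.

Lemma normsqM z w : normsq (z * w) = normsq z * normsq w.
Proof. by rewrite /normsq !ReImE; ring. Qed.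

Lemma normsqJ z : normsq (conjc z) = normsq z.
Proof. by rewrite /normsq !ReImE sqrrN. Qed.

Lemma normsqN z : normsq (- z) = normsq z.
Proof. by rewrite /normsq !ReImE !sqrrN. Qed.

Lemma normsqC (r : R) : normsq r%:C%C = r ^+ 2.
Proof. by rewrite /normsq /= expr0n /= addr0. Qed.

Lemma conjcZ (r : R) z : conjc (r%:C%C * z) = r%:C%C * conjc z.
Proof. by apply: complexP; rewrite !ReImE /=; ring. Qed.

Lemma normsqD_le z w : normsq (z + w) <= 2 * (normsq z + normsq w).
Proof.
rewrite /normsq !ReImE.
have := sqr_ge0 (complex.Re z - complex.Re w).
have := sqr_ge0 (complex.Im z - complex.Im w).
nra.
Qed.

Lemma mul_conjc z : conjc z * z = (normsq z)%:C%C.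
Proof. by apply: complexP; rewrite /normsq !ReImE /=; ring. Qed.

Lemma normcE2 z : Normc.normc z ^+ 2 = normsq z.
Proof. by case: z => a b; rewrite /= sqr_sqrtr// addr_ge0// sqr_ge0. Qed.

Lemma normc_sqrt z : Normc.normc z = Num.sqrt (normsq z).
Proof. by case: z. Qed.

Lemma abs_Re_conjcM z w : `|complex.Re (conjc z * w)| <= normsq z + normsq w.
Proof.
rewrite !ReImE /normsq ler_norml; move: (complex.Re z) (complex.Im z).
move: (complex.Re w) (complex.Im w) => a b c d.
have := (sqr_ge0 (a - c), sqr_ge0 (a + c), sqr_ge0 (b - d), sqr_ge0 (b + d)).
by move=> [[[h1 h2] h3] h4]; apply/andP; split; nra.
Qed.

Lemma abs_Im_conjcM z w : `|complex.Im (conjc z * w)| <= normsq z + normsq w.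
Proof.
rewrite !ReImE /normsq ler_norml; move: (complex.Re z) (complex.Im z).
move: (complex.Re w) (complex.Im w) => a b c d.
have := (sqr_ge0 (b - c), sqr_ge0 (b + c), sqr_ge0 (a - d), sqr_ge0 (a + d)).
by move=> [[[h1 h2] h3] h4]; apply/andP; split; nra.
Qed.

End ComplexNumbers.

Section CMeasurable.
Context {d : measure_display} {T : measurableType d} {R : realType}.
Implicit Types f g : T -> R[i].

Lemma cmeasurable_cst (c : R[i]) : cmeasurable (fun _ : T => c).
Proof. by split; exact: measurable_cst. Qed.

Lemma cmeasurableD f g : cmeasurable f -> cmeasurable g ->
  cmeasurable (fun x => f x + g x).
Proof.
move=> [f1 f2] [g1 g2]; split.
  under eq_fun do rewrite ReD.
  exact: measurable_funD.
under eq_fun do rewrite ImD.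
exact: measurable_funD.
Qed.

Lemma cmeasurableM f g : cmeasurable f -> cmeasurable g ->
  cmeasurable (fun x => f x * g x).
Proof.
move=> [f1 f2] [g1 g2]; split.
  under eq_fun do rewrite ReM.
  by apply: measurable_funB; exact: measurable_funM.
under eq_fun do rewrite ImM.
by apply: measurable_funD; exact: measurable_funM.
Qed.

Lemma cmeasurableJ f : cmeasurable f -> cmeasurable (fun x => conjc (f x)).
Proof.
move=> [f1 f2]; split.
  by under eq_fun do rewrite Re_conjc.
under eq_fun do rewrite Im_conjc.
exact: measurableT_comp.
Qed.

Lemma cmeasurableN f : cmeasurable f -> cmeasurable (fun x => - f x).
Proof.
move=> [f1 f2]; split.
  by under eq_fun do rewrite ReN; exact: measurableT_comp.
by under eq_fun do rewrite ImN; exact: measurableT_comp.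
Qed.

Lemma cmeasurable_real (f : T -> R) :
  measurable_fun setT f -> cmeasurable (fun x => (f x)%:C%C).
Proof. by move=> mf; split => //=; exact: measurable_cst. Qed.

Lemma measurable_normsq f : cmeasurable f ->
  measurable_fun setT (fun x => normsq (f x)).
Proof.
move=> [f1 f2]; apply: measurable_funD.
  exact: (measurableT_comp (exprn_measurable 2) f1).
exact: (measurableT_comp (exprn_measurable 2) f2).
Qed.

End CMeasurable.

Lemma cmeasurable_comp {d d'} {T : measurableType d} {T' : measurableType d'}
    {R : realType} (f : T' -> R[i]) (t : T -> T') :
  cmeasurable f -> measurable_fun setT t -> cmeasurable (fun x => f (t x)).
Proof.
move=> [f1 f2] mt.
by split; [exact: (measurableT_comp f1 mt)|exact: (measurableT_comp f2 mt)].
Qed.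

Section CIntegral.
Context {d : measure_display} {T : measurableType d} {R : realType}.
Variable nu : {measure set T -> \bar R}.
Implicit Types f g : T -> R[i].

Definition cintegrable f :=
  nu.-integrable setT (EFin \o (fun x => complex.Re (f x))) /\
  nu.-integrable setT (EFin \o (fun x => complex.Im (f x))).

Lemma le_rintegrable (f G : T -> R) : measurable_fun setT f ->
  nu.-integrable setT (EFin \o G) -> (forall x, `|f x| <= G x) ->
  nu.-integrable setT (EFin \o f).
Proof.
move=> mf iG fG; apply: le_integrable iG => //; first exact/measurable_EFinP.
by move=> x _ /=; rewrite lee_fin (le_trans (fG x))// ler_norm.
Qed.

Lemma le_cintegrable f (G : T -> R) : cmeasurable f ->
  nu.-integrable setT (EFin \o G) ->
  (forall x, `|complex.Re (f x)| <= G x /\ `|complex.Im (f x)| <= G x) ->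
  cintegrable f.
Proof.
move=> [f1 f2] iG fG.
by split; apply: (le_rintegrable _ iG) => // x; case: (fG x).
Qed.

Lemma rintegrableD (f g : T -> R) : nu.-integrable setT (EFin \o f) ->
  nu.-integrable setT (EFin \o g) ->
  nu.-integrable setT (EFin \o (fun x => f x + g x)).
Proof. by move=> fi gi; exact: (integrableD _ fi gi). Qed.

Lemma rintegrableB (f g : T -> R) : nu.-integrable setT (EFin \o f) ->
  nu.-integrable setT (EFin \o g) ->
  nu.-integrable setT (EFin \o (fun x => f x - g x)).
Proof. by move=> fi gi; exact: (integrableB _ fi gi). Qed.

Lemma rintegrableZ (f : T -> R) (c : R) : nu.-integrable setT (EFin \o f) ->
  nu.-integrable setT (EFin \o (fun x => c * f x)).
Proof. by move=> fi; exact: (integrableZl _ c fi). Qed.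

Lemma cintegralD f g : cintegrable f -> cintegrable g ->
  cintegral nu (fun x => f x + g x) = cintegral nu f + cintegral nu g.
Proof.
move=> [f1 f2] [g1 g2]; apply: complexP; rewrite ReImE /=.
  by under eq_Rintegral do rewrite ReD; rewrite RintegralD.
by under eq_Rintegral do rewrite ImD; rewrite RintegralD.
Qed.

Lemma cintegralZ f (c : R[i]) : cintegrable f ->
  cintegral nu (fun x => c * f x) = c * cintegral nu f.
Proof.
move=> [f1 f2]; apply: complexP; rewrite ReImE /=.
  under eq_Rintegral do rewrite ReM.
  by rewrite RintegralB ?RintegralZl//; exact: rintegrableZ.
under eq_Rintegral do rewrite ImM.
by rewrite RintegralD ?RintegralZl//; exact: rintegrableZ.
Qed.


Lemma cintegralJ f : cintegrable f ->
  cintegral nu (fun x => conjc (f x)) = conjc (cintegral nu f).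
Proof.
move=> [f1 f2]; apply: complexP; rewrite ReImE /=.
  by under eq_Rintegral do rewrite Re_conjc.
under eq_Rintegral do rewrite Im_conjc -mulN1r.
by rewrite RintegralZl// mulN1r.
Qed.

Lemma eq_cintegral f g : f =1 g -> cintegral nu f = cintegral nu g.
Proof. by move=> /funext ->. Qed.

Lemma ae_eq_Rintegral (f g : T -> R) :
  measurable_fun setT f -> measurable_fun setT g ->
  {ae nu, forall x, f x = g x} -> (\int[nu]_x f x = \int[nu]_x g x)%R.
Proof.
move=> mf mg fg; congr fine; apply: ae_eq_integral => //.
- exact/measurable_EFinP.
- exact/measurable_EFinP.
- by apply: filterS fg => x -> _.
Qed.

Lemma ae_eq_cintegral f g : cmeasurable f -> cmeasurable g ->
  {ae nu, forall x, f x = g x} -> cintegral nu f = cintegral nu g.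
Proof.
move=> [f1 f2] [g1 g2] fg; congr Complex; apply: ae_eq_Rintegral => //;
by apply: filterS fg => x ->.
Qed.

Lemma cintegral0 : cintegral nu (fun _ => 0) = 0.
Proof. by apply: complexP => /=; rewrite /Rintegral integral0. Qed.

Lemma Rintegral_eq0_ae (f : T -> R) : nu.-integrable setT (EFin \o f) ->
  (forall x, 0 <= f x) -> (\int[nu]_x f x = 0)%R ->
  {ae nu, forall x, f x = 0}.
Proof.
move=> fi f0 If0.
have mf := measurable_int _ fi.
have : (\int[nu]_x `|(f x)%:E| = 0)%E.
  rewrite (eq_integral (EFin \o f)); last by move=> x _; rewrite gee0_abs ?lee_fin.
  by rewrite -[LHS]fineK ?integrable_fin_num//; congr EFin.
move/(ae_eq_integral_abs nu measurableT mf).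
by apply: filterS => x /= /(_ I) [].
Qed.

End CIntegral.

(** * Convergence of real sequences with a rate, and a Bernoulli bound *)

Section RealSequences.
Context {R : realType}.

Lemma le0_of_cvg0 (x C : R) (eps : R^nat) : eps @ \oo --> (0 : R) ->
  (forall n, x <= C * eps n) -> x <= 0.
Proof.
move=> e0 xe; have : (fun n => C * eps n) @ \oo --> C * 0.
  by apply: cvgM => //; exact: cvg_cst.
by rewrite mulr0 => /cvgr_to_ge; apply; exact: nearW.
Qed.

(** Cauchy-Schwarz bounds squares, so the Cauchy condition is squared too. Letting [m] tend to
    infinity hands the rate [eps n] over to the limit. *)
Lemma cauchy_sqr_cvg (r eps : R^nat) : eps @ \oo --> (0 : R) ->
  (forall n m, (n <= m)%N -> (r n - r m) ^+ 2 <= eps n) ->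
  cvgn r /\ forall n, (r n - limn r) ^+ 2 <= eps n.
Proof.
move=> e0 re; have cr : cvgn r.
  apply/cauchy_cvgP/cauchy_ballP => _/posnumP[e].
  have e2 : 0 < (e%:num / 2) ^+ 2 by [].
  have [N _ HN] : \forall n \near \oo, eps n < (e%:num / 2) ^+ 2.
    move/cvgrPdist_lt : e0 => /(_ _ e2); apply: filterS => n.
    by rewrite sub0r normrN; apply: le_lt_trans; exact: ler_norm.
  have H n : (N <= n)%N -> `|r N - r n| < e%:num / 2.
    move=> Nn; rewrite -(@ltr_pXn2r _ 2)// ?nnegrE// real_normK ?num_real//.
    exact: le_lt_trans (re _ _ Nn) (HN N (leqnn N)).
  near_simpl; near=> n m => /=.
  rewrite /ball /= -[r n](subrK (r N)) -addrA (le_lt_trans (ler_normD _ _))//.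
  rewrite [ltRHS]splitr ltrD//.
    by rewrite distrC H//; near: n; exists N.
  by rewrite H//; near: m; exists N.
split => // n; have : (fun m => (r n - r m) ^+ 2) @ \oo --> (r n - limn r) ^+ 2.
  under eq_fun do rewrite expr2; rewrite expr2.
  by apply: cvgM; apply: cvgB => //; exact: cvg_cst.
move/cvgr_to_le; apply; exists n => // m /=; exact: re.
Unshelve. all: by end_near.
Qed.

(** Bernoulli's inequality at [x = 1 / (2 (n + 1))], where [1 - (n + 1) x] is exactly one half. This
    is the defect allowed to near-maximizers in [opnorm2_approx]. *)
Lemma bernoulli_half (n : nat) : 2^-1 <= (1 - (2 * n.+1%:R)^-1) ^+ n.+1 :> R.
Proof.
have B (x : R) m : 0 <= x -> x <= 1 -> 1 - m%:R * x <= (1 - x) ^+ m.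
  move=> x0 x1; elim: m => [|m IH]; first by rewrite mul0r subr0 expr0.
  rewrite exprS; apply: le_trans (ler_wpM2l _ IH); last by rewrite subr_ge0.
  have : 0 <= m%:R * x * x by rewrite !mulr_ge0.
  by rewrite -natr1; lra.
apply: le_trans (B _ _ _ _).
- by rewrite invfM mulrCA divff ?pnatr_eq0// mulr1; lra.
- by rewrite invr_ge0 mulr_ge0.
- by rewrite invf_le1 ?mulr_gt0// -natrM ler1n.
Qed.

End RealSequences.

(** * Square-integrable functions and their inner product *)

Section SquareIntegrable.
Context {d : measure_display} {T : measurableType d} {R : realType}.
Variable nu : {measure set T -> \bar R}.
Implicit Types f g h : T -> R[i].

Definition sqint f :=
  cmeasurable f /\ nu.-integrable setT (EFin \o (fun x => normsq (f x))).

Definition ip f g : R[i] := cintegral nu (fun x => conjc (f x) * g x).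

Definition nrm f : R := (\int[nu]_x normsq (f x))%R.

Lemma cLnorm2_sqr f :
  (cLnorm nu 2%:E f `^ 2 = \int[nu]_x `|(normsq (f x))%:E|)%E.
Proof.
rewrite poweR_Lnorm//; apply: eq_integral => x _.
rewrite /= powR_mulrn ?normr_ge0// real_normK ?num_real// normcE2.
by rewrite ger0_norm ?normsq_ge0.
Qed.

Lemma cL2_sqint f : cL2 nu f <-> sqint f.
Proof.
have P : (cLnorm nu 2%:E f < +oo)%E <->
         (\int[nu]_x `|(normsq (f x))%:E| < +oo)%E.
  rewrite -cLnorm2_sqr; split => [?|]; first exact: poweR_lty.
  rewrite /cLnorm; case: (Lnorm _ _ _) => [r _||//]; first by rewrite ltry.
  by rewrite /poweR pnatr_eq0.
split=> [[mf /P lf]|[mf /integrableP[_ lf]]].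
  split => //; apply/integrableP; split => //; apply/measurable_EFinP.
  exact: measurable_normsq.
by split => //; apply/P.
Qed.

Lemma nrm_cLnorm_le1 f : sqint f -> (cLnorm nu 2%:E f <= 1)%E -> nrm f <= 1.
Proof.
move=> [mf fi] f1; rewrite -lee_fin /nrm /Rintegral fineK ?integrable_fin_num//.
rewrite (eq_integral (fun x => `|(normsq (f x))%:E|%E)); last first.
  by move=> x _; rewrite gee0_abs// lee_fin normsq_ge0.
rewrite -cLnorm2_sqr; rewrite -[leRHS](poweR1r 2).
apply: gt0_ler_poweR f1 => //.
- by rewrite in_itv /= Lnorm_ge0 leey.
- by rewrite in_itv /= leey lee_fin ler01.
Qed.

Lemma sqint_cintegrable f g : sqint f -> sqint g ->
  cintegrable nu (fun x => conjc (f x) * g x).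
Proof.
move=> [mf fi] [mg gi].
apply: (le_cintegrable _ (rintegrableD fi gi)).
  by apply: cmeasurableM => //; exact: cmeasurableJ.
by move=> x; split; [exact: abs_Re_conjcM|exact: abs_Im_conjcM].
Qed.

Lemma sqintD f g : sqint f -> sqint g -> sqint (fun x => f x + g x).
Proof.
move=> [mf fi] [mg gi]; have mfg := cmeasurableD mf mg; split => //.
apply: (le_rintegrable _ (rintegrableZ 2 (rintegrableD fi gi))).
  exact: measurable_normsq.
by move=> x; rewrite ger0_norm ?normsq_ge0// normsqD_le.
Qed.

Lemma sqintZ f (c : R[i]) : sqint f -> sqint (fun x => c * f x).
Proof.
move=> [mf fi]; split; first by apply: cmeasurableM => //; exact: cmeasurable_cst.
by under [_ \o _]eq_fun do rewrite /= normsqM; exact: rintegrableZ.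
Qed.

Lemma sqintN f : sqint f -> sqint (fun x => - f x).
Proof.
by move=> [mf fi]; split; [exact: cmeasurableN|under [_ \o _]eq_fun do rewrite /= normsqN].
Qed.

Lemma sqintB f g : sqint f -> sqint g -> sqint (fun x => f x - g x).
Proof. by move=> fi gi; exact: (sqintD fi (sqintN gi)). Qed.

Lemma sqint0 : sqint (fun _ => 0).
Proof.
split; first exact: cmeasurable_cst.
rewrite (_ : EFin \o _ = cst 0%E); first exact: integrable0.
by apply/funext => x /=; rewrite /normsq /= !expr0n /= addr0.
Qed.

Lemma sqint_sum I (s : seq I) (c : I -> R[i]) (e : I -> T -> R[i]) :
  (forall i, sqint (e i)) -> sqint (fun x => \sum_(i <- s) c i * e i x).
Proof.
move=> se; elim: s => [|i s IH].
  by under eq_fun do rewrite big_nil; exact: sqint0.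
by under eq_fun do rewrite big_cons; apply: sqintD => //; exact: sqintZ.
Qed.

Lemma ipDr h f g : sqint h -> sqint f -> sqint g ->
  ip h (fun x => f x + g x) = ip h f + ip h g.
Proof.
move=> sh sf sg; rewrite /ip -cintegralD; try exact: sqint_cintegrable.
by apply: eq_cintegral => x; rewrite mulrDr.
Qed.

Lemma ipZr h f c : sqint h -> sqint f ->
  ip h (fun x => c * f x) = c * ip h f.
Proof.
move=> sh sf; rewrite /ip -cintegralZ; try exact: sqint_cintegrable.
by apply: eq_cintegral => x; rewrite mulrCA.
Qed.

Lemma ipC f g : sqint f -> sqint g -> ip g f = conjc (ip f g).
Proof.
move=> sf sg; rewrite /ip -cintegralJ; last exact: sqint_cintegrable.
by apply: eq_cintegral => x; rewrite rmorphM /= conjcK mulrC.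
Qed.

Lemma ipNr h f : sqint h -> sqint f -> ip h (fun x => - f x) = - ip h f.
Proof.
move=> sh sf; rewrite -mulN1r -ipZr//.
by congr ip; apply/funext => x; rewrite mulN1r.
Qed.

Lemma ipBr h f g : sqint h -> sqint f -> sqint g ->
  ip h (fun x => f x - g x) = ip h f - ip h g.
Proof. by move=> sh sf sg; rewrite (ipDr sh sf (sqintN sg)) ipNr. Qed.

Lemma ipZl h f c : sqint h -> sqint f ->
  ip (fun x => c * f x) h = conjc c * ip f h.
Proof.
by move=> sh sf; rewrite (ipC sh (sqintZ c sf)) ipZr// rmorphM /= (ipC sh sf).
Qed.

Lemma ipBl h f g : sqint h -> sqint f -> sqint g ->
  ip (fun x => f x - g x) h = ip f h - ip g h.
Proof.
by move=> sh sf sg; rewrite (ipC sh (sqintB sf sg)) ipBr// rmorphB /= (ipC sh sf) (ipC sh sg).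
Qed.

Lemma ip_sumr h I (s : seq I) (c : I -> R[i]) (e : I -> T -> R[i]) :
  sqint h -> (forall i, sqint (e i)) ->
  ip h (fun x => \sum_(i <- s) c i * e i x) = \sum_(i <- s) c i * ip h (e i).
Proof.
move=> sh se; elim: s => [|i s IH].
  rewrite big_nil /ip -[RHS](cintegral0 nu); apply: eq_cintegral => x.
  by rewrite big_nil mulr0.
rewrite big_cons -IH -ipZr// -ipDr//; last 2 first.
- exact: sqintZ.
- exact: sqint_sum.
by congr ip; apply/funext => x; rewrite big_cons.
Qed.

Lemma ip_nrm f : ip f f = (nrm f)%:C%C.
Proof.
apply: complexP => /=; rewrite /nrm; first by under eq_Rintegral do rewrite mul_conjc.
under eq_Rintegral do rewrite mul_conjc/=.
by rewrite /Rintegral integral0.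
Qed.

Lemma nrm_ge0 f : 0 <= nrm f.
Proof. by apply: Rintegral_ge0 => x _; exact: normsq_ge0. Qed.

Lemma nrm_eq0 f : sqint f -> nrm f = 0 -> {ae nu, forall x, f x = 0}.
Proof.
move=> [mf fi] f0; have := Rintegral_eq0_ae fi (fun x => normsq_ge0 (f x)) f0.
by apply: filterS => x; exact: normsq_eq0.
Qed.

Lemma ae_eq_ipr h f g : sqint h -> sqint f -> sqint g ->
  {ae nu, forall x, f x = g x} -> ip h f = ip h g.
Proof.
move=> [mh _] [mf _] [mg _] fg; apply: ae_eq_cintegral.
- by apply: cmeasurableM => //; exact: cmeasurableJ.
- by apply: cmeasurableM => //; exact: cmeasurableJ.
- by apply: filterS fg => x ->.
Qed.

Lemma ae_eq_ipl h f g : sqint h -> sqint f -> sqint g ->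
  {ae nu, forall x, f x = g x} -> ip f h = ip g h.
Proof.
by move=> sh sf sg fg; rewrite (ipC sh sf) (ipC sh sg) (ae_eq_ipr sh sf sg fg).
Qed.

Lemma ae_eq_nrm f g : cmeasurable f -> cmeasurable g ->
  {ae nu, forall x, f x = g x} -> nrm f = nrm g.
Proof.
move=> mf mg fg; apply: ae_eq_Rintegral; try exact: measurable_normsq.
by apply: filterS fg => x ->.
Qed.

Lemma ip0r h : ip h (fun _ => 0) = 0.
Proof. by rewrite -[RHS](cintegral0 nu); apply: eq_cintegral => x; rewrite mulr0. Qed.

Lemma nrmZ f c : sqint f -> nrm (fun x => c * f x) = normsq c * nrm f.
Proof.
move=> [mf fi]; rewrite /nrm -RintegralZl//.
by apply: eq_Rintegral => x _; rewrite normsqM.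
Qed.

Lemma nrmB f g : sqint f -> sqint g ->
  nrm (fun x => f x - g x) = nrm f + nrm g - 2 * complex.Re (ip f g).
Proof.
move=> sf sg; apply: (complexI (R := R)); rewrite -ip_nrm.
rewrite ipBl ?ipBr//; try exact: sqintB.
rewrite !ip_nrm (ipC sf sg) !rmorphB /= rmorphD /=.
by apply: complexP; rewrite !ReImE /=; ring.
Qed.

Lemma nrmD_le f g : sqint f -> sqint g ->
  nrm (fun x => f x + g x) <= 2 * (nrm f + nrm g).
Proof.
move=> sf sg; have [_ ifg] := sqintD sf sg; case: sf sg => [mf fi] [mg gi].
rewrite /nrm -RintegralD// -RintegralZl//; last exact: rintegrableD.
apply: le_Rintegral => //; first by apply: rintegrableZ; exact: rintegrableD.
by move=> x _; exact: normsqD_le.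
Qed.

Lemma cauchy_schwarz f g : sqint f -> sqint g ->
  normsq (ip f g) <= nrm f * nrm g.
Proof.
move=> sf sg; set a := ip f g.
have [f0|] := eqVneq (nrm f) 0.
  have -> : a = 0.
    rewrite /a ipC// (ae_eq_ipr sg sf sqint0) ?ip0r ?conjc0//.
    exact: nrm_eq0.
  by rewrite f0 mul0r /normsq /= expr0n /= addr0.
rewrite neq_lt ltNge nrm_ge0 /= => f0.
have sZ c : sqint (fun x => c * f x) by exact: sqintZ.
(* The projection of [g] to the line of [f] is [(a / nrm f) f]. With the denominator cleared, the
   squared norm of the remainder is [nrm f * (nrm f * nrm g - normsq a)]. *)
have : 0 <= nrm (fun x => (nrm f)%:C%C * g x - a * f x) by exact: nrm_ge0.
rewrite nrmB//; try exact: sqintZ.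
rewrite !nrmZ// ipZl ?ipZr// normsqC (ipC sf sg) -/a.
rewrite conjc_real; clearbody a; rewrite !ReImE /= => h.
have {h} : 0 <= nrm f * (nrm f * nrm g - normsq a).
  apply: le_trans h _; rewrite /normsq; lra.
by rewrite pmulr_rge0// subr_ge0.
Qed.

End SquareIntegrable.

Lemma sqint_cst {d : measure_display} {T : measurableType d} {R : realType}
  (nu : {finite_measure set T -> \bar R}) (c : R[i]) : sqint nu (fun _ => c).
Proof. by split; [exact: cmeasurable_cst|exact: finite_measure_integrable_cst]. Qed.

Lemma ip1_cst {d : measure_display} {T : measurableType d} {R : realType}
  (nu : probability T R) (c : R[i]) : ip nu (fun _ => 1) (fun _ => c) = c.
Proof.
rewrite /ip (_ : (fun _ => _) = (fun _ => c)); last first.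
  by apply/funext => x; rewrite conjc1 mul1r.
have nu1 := congr1 fine (probability_setT nu).
by apply: complexP => /=; rewrite Rintegral_cst// (_ : fine _ = 1) ?mulr1.
Qed.

(** * Change of variables along measure-preserving maps *)

Section MeasurePreserving.
Context {d d' : measure_display} {T : measurableType d} {T' : measurableType d'}.
Context {R : realType}.
Variables (nu : {measure set T -> \bar R}) (nu' : {measure set T' -> \bar R}).
Variable t : T -> T'.
Hypothesis mt : measurable_fun setT t.
Hypothesis pt : forall A, measurable A -> nu (t @^-1` A) = nu' A.

Lemma ge0_integral_preserving (f : T' -> \bar R) : measurable_fun setT f ->
  (forall x, 0 <= f x)%E -> (\int[nu]_x f (t x) = \int[nu']_x f x)%E.
Proof.
move=> mf f0.
have := @ge0_integral_pushforward _ _ _ _ _ t mt nu setT f measurableT mf.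
rewrite preimage_setT => <-//; apply: eq_measure_integral => A mA _.
by rewrite -pt.
Qed.

Lemma integral_preserving (f : T' -> \bar R) : measurable_fun setT f ->
  (\int[nu]_x f (t x) = \int[nu']_x f x)%E.
Proof.
move=> mf; rewrite integralE [in RHS]integralE.
congr (_ - _)%E.
  rewrite -(ge0_integral_preserving (f := f^\+)%E)//; last exact: measurable_funepos.
  by apply: eq_integral => x _; rewrite !funeposE.
rewrite -(ge0_integral_preserving (f := f^\-)%E)//; last exact: measurable_funeneg.
by apply: eq_integral => x _; rewrite !funenegE.
Qed.

Lemma Rintegral_preserving (f : T' -> R) : measurable_fun setT f ->
  (\int[nu]_x f (t x) = \int[nu']_x f x)%R.
Proof.
move=> mf; congr fine; rewrite -(integral_preserving (f := EFin \o f))//.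
exact/measurable_EFinP.
Qed.

Lemma integrable_preserving (f : T' -> R) : nu'.-integrable setT (EFin \o f) ->
  nu.-integrable setT (EFin \o (fun x => f (t x))).
Proof.
move=> /integrableP[mf lf]; apply/integrableP; split.
  exact: (measurableT_comp mf mt).
move: lf; rewrite -(ge0_integral_preserving (f := abse \o (EFin \o f)))//.
  exact: measurableT_comp.
by move=> x; exact: abse_ge0.
Qed.

Lemma cintegral_preserving (f : T' -> R[i]) : cmeasurable f ->
  cintegral nu (fun x => f (t x)) = cintegral nu' f.
Proof.
move=> [f1 f2]; congr Complex.
  exact: (Rintegral_preserving f1).
exact: (Rintegral_preserving f2).
Qed.

Lemma ae_preserving (P : T' -> Prop) :
  {ae nu', forall x, P x} -> {ae nu, forall x, P (t x)}.
Proof.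
move=> [N [mN N0 PN]]; exists (t @^-1` N); split.
- by rewrite -[X in measurable X]setTI; exact: mt.
- by rewrite pt.
- by move=> x /= nP; exact: PN.
Qed.

Lemma sqint_preserving (f : T' -> R[i]) : sqint nu' f -> sqint nu (fun x => f (t x)).
Proof.
by move=> [mf fi]; split; [exact: (cmeasurable_comp mf mt)|exact: (integrable_preserving fi)].
Qed.

Lemma nrm_preserving (f : T' -> R[i]) : cmeasurable f ->
  nrm nu (fun x => f (t x)) = nrm nu' f.
Proof. by move=> /measurable_normsq mf; exact: (Rintegral_preserving mf). Qed.

Lemma ip_preserving (f g : T' -> R[i]) : cmeasurable f -> cmeasurable g ->
  ip nu (fun x => f (t x)) (fun x => g (t x)) = ip nu' f g.
Proof.
move=> mf mg.
rewrite /ip (cintegral_preserving (f := fun x => conjc (f x) * g x))//.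
by apply: cmeasurableM => //; exact: cmeasurableJ.
Qed.

End MeasurePreserving.

(** * Hilbert-Schmidt operators *)

Section KernelOperator.
Context {d : measure_display} {T : measurableType d} {R : realType}.
Variable nu : probability T R.
Local Notation nu2 := (nu \x nu)%E.
Implicit Types (k : T * T -> R[i]) (f g : T -> R[i]).

Definition kop k f x : R[i] := cintegral nu (fun y => k (x, y) * f y).

Lemma cmeasurable_pairl k x : cmeasurable k -> cmeasurable (fun y => k (x, y)).
Proof. by move=> mk; apply: (cmeasurable_comp mk); exact: measurable_pair1. Qed.

Lemma cmeasurable_pairr k y : cmeasurable k -> cmeasurable (fun x => k (x, y)).
Proof. by move=> mk; apply: (cmeasurable_comp mk); exact: measurable_pair2. Qed.

Lemma cmeasurable_swap k : cmeasurable k -> cmeasurable (fun z => k (z.2, z.1)).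
Proof.
move=> mk; apply: (cmeasurable_comp (t := fun z : T * T => (z.2, z.1)) mk).
by apply/measurable_fun_pairP; split; [exact: measurable_snd|exact: measurable_fst].
Qed.

Lemma cmeasurable_kernelM k f g : cmeasurable k -> cmeasurable f ->
  cmeasurable g -> cmeasurable (fun z : T * T => f z.1 * k z * g z.2).
Proof.
move=> mk mf mg; apply: cmeasurableM.
  apply: cmeasurableM => //; apply: (cmeasurable_comp mf).
  exact: measurable_fst.
by apply: (cmeasurable_comp mg); exact: measurable_snd.
Qed.

(** Tonelli applies to the positive and the negative part separately. Sections that are not
    integrable receive a default value through [fine], which does not harm measurability. *)
Lemma measurable_Rintegral_snd (h : T * T -> R) : measurable_fun setT h ->
  measurable_fun setT (fun x => \int[nu]_y h (x, y))%R.
Proof.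
move=> mh; have mh' : measurable_fun setT (EFin \o h) by exact/measurable_EFinP.
have -> : (fun x => \int[nu]_y h (x, y))%R =
   fine \o (fun x => fubini_F nu (EFin \o h)^\+ x - fubini_F nu (EFin \o h)^\- x)%E.
  apply/funext => x; rewrite /Rintegral /= integralE.
  by congr (fine (_ - _)%E); apply: eq_integral => y _; rewrite ?funeposE ?funenegE.
apply: measurableT_comp => //.
by apply: emeasurable_funB; apply: measurable_fun_fubini_tonelli_F => //;
  [exact: measurable_funepos|exact: measurable_funeneg].
Qed.

Lemma cmeasurable_cintegral_snd k : cmeasurable k ->
  cmeasurable (fun x => cintegral nu (fun y => k (x, y))).
Proof. 
move=> [k1 k2]; split.
  exact: (measurable_Rintegral_snd (h := fun z => complex.Re (k z))).
exact: (measurable_Rintegral_snd (h := fun z => complex.Im (k z))). Qed.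

Lemma cmeasurable_kop k f : cmeasurable k -> cmeasurable f ->
  cmeasurable (kop k f).
Proof.
move=> mk mf.
apply: (cmeasurable_cintegral_snd (k := fun z => k z * f z.2)).
apply: cmeasurableM => //; apply: (cmeasurable_comp mf).
exact: measurable_snd.
Qed.

Lemma Rfubini (h : T * T -> R) : nu2.-integrable setT (EFin \o h) ->
  (\int[nu2]_z h z = \int[nu]_x \int[nu]_y h (x, y))%R /\
  (\int[nu2]_z h z = \int[nu]_y \int[nu]_x h (x, y))%R.
Proof.
move=> ih; rewrite /Rintegral; split.
  rewrite -integral12_prod_meas1//; congr fine.
  apply: ae_eq_integral => //.
  - exact: (measurable_fubini_F ih).
  - apply/measurable_EFinP/measurable_Rintegral_snd/measurable_EFinP.
    exact: (measurable_int _ ih).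
  (* Almost every section is integrable, so taking [fine] of the inner integral changes nothing
     outside a null set. *)
  - apply: filterS (ae_integrable1 ih) => x ix _.
    by rewrite fineK//; exact: integrable_fin_num.
rewrite -integral21_prod_meas1//; congr fine.
have mh : measurable_fun setT h by apply/measurable_EFinP; exact: (measurable_int _ ih).
apply: ae_eq_integral => //.
- exact: (measurable_fubini_G ih).
- apply/measurable_EFinP.
  apply: (measurable_Rintegral_snd (h := fun z => h (z.2, z.1))).
  apply: (measurableT_comp mh).
  by apply/measurable_fun_pairP; split; [exact: measurable_snd|exact: measurable_fst].
- apply: filterS (ae_integrable2 ih) => x ix _.
  by rewrite fineK//; exact: integrable_fin_num.
Qed.

Lemma cfubini k : cintegrable nu2 k ->
  cintegral nu2 k = cintegral nu (fun x => cintegral nu (fun y => k (x, y))) /\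
  cintegral nu2 k = cintegral nu (fun y => cintegral nu (fun x => k (x, y))).
Proof.
move=> [k1 k2]; have [a1 a2] := Rfubini k1; have [b1 b2] := Rfubini k2.
by split; rewrite {1}/cintegral; [rewrite a1 b1|rewrite a2 b2].
Qed.

Lemma integrable_prod (f g : T -> R) : (forall x, 0 <= f x) -> (forall x, 0 <= g x) ->
  nu.-integrable setT (EFin \o f) -> nu.-integrable setT (EFin \o g) ->
  nu2.-integrable setT (EFin \o (fun z => f z.1 * g z.2)).
Proof.
move=> f0 g0 fi gi.
have mf : measurable_fun setT f by apply/measurable_EFinP; exact: (measurable_int _ fi).
have mg : measurable_fun setT g by apply/measurable_EFinP; exact: (measurable_int _ gi).
apply/integrable12ltyP.
  apply/measurable_EFinP; apply: measurable_funM.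
    exact: (measurableT_comp mf measurable_fst).
  exact: (measurableT_comp mg measurable_snd).
under eq_integral => x _.
  under eq_integral do rewrite /= ger0_norm ?mulr_ge0// EFinM.
  rewrite integralZl//.
  over.
rewrite /=.
have [r ->] : exists r, (\int[nu]_x (g x)%:E)%E = r%:E.
  by exists (fine (\int[nu]_x (g x)%:E))%E; rewrite fineK//; exact: integrable_fin_num.
rewrite integralZr//.
by rewrite -(fineK (integrable_fin_num _ fi))// -EFinM ltry.
Qed.

Lemma sqint_kernelM k f g : sqint nu2 k -> sqint nu f -> sqint nu g ->
  cintegrable nu2 (fun z => conjc (f z.1) * k z * g z.2).
Proof.
move=> [mk ki] [mf fi] [mg gi].
have fgi := integrable_prod (fun x => normsq_ge0 (f x)) (fun x => normsq_ge0 (g x)) fi gi.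
apply: (le_cintegrable _ (rintegrableD fgi ki)).
  exact: (cmeasurable_kernelM mk (cmeasurableJ mf) mg).
(* Read as the product of [k] with a function of tensor form, the integrand is dominated by the sum
   of the two squared moduli. *)
move=> z; have -> : conjc (f z.1) * k z * g z.2 =
    conjc (f z.1 * conjc (g z.2)) * k z.
  by rewrite rmorphM /= conjcK mulrAC.
rewrite -[normsq (g z.2)]normsqJ -normsqM.
by split; [exact: abs_Re_conjcM|exact: abs_Im_conjcM].
Qed.

End KernelOperator.

(** * Null sets and kernels on the product space *)

Section AlmostEverywhereSections.
Context {d : measure_display} {T : measurableType d} {R : realType}.
Variable nu : probability T R.

(** The measure of a null set is the integral of the measures of its sections, which therefore
    vanish almost everywhere. *)
Lemma ae_section (P : T * T -> Prop) : {ae (nu \x nu)%E, forall z, P z} ->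
  {ae nu, forall x, {ae nu, forall y, P (x, y)}}.
Proof.
move=> [N [mN N0 PN]].
have : {ae nu, forall x, nu (xsection N x) = 0%E}.
  have mx := measurable_fun_xsection nu mN.
  have /(ae_eq_integral_abs nu measurableT mx) :
      (\int[nu]_x `|(nu \o xsection N) x| = 0)%E.
    rewrite -[RHS]N0; apply: eq_integral => x _.
    by rewrite gee0_abs//; exact: measure_ge0.
  by apply: filterS => x /(_ I).
apply: filterS => x x0; exists (xsection N x); split => //.
  exact: measurable_xsection.
by move=> y /= nP; apply/xsectionP; exact: PN.
Qed.

Lemma ae_forall_ord n (P : 'I_n -> T -> Prop) :
  (forall i, {ae nu, forall x, P i x}) -> {ae nu, forall x, forall i, P i x}.
Proof. by move=> aeP; exact: filter_forall. Qed.

End AlmostEverywhereSections.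

Section ProductMaps.
Context {d : measure_display} {T : measurableType d} {R : realType}.
Variable nu : probability T R.
Local Notation nu2 := (nu \x nu)%E.

Lemma measurable_swap : measurable_fun setT (fun z : T * T => (z.2, z.1)).
Proof.
by apply/measurable_fun_pairP; split; [exact: measurable_snd|exact: measurable_fst].
Qed.

(** Swapping the coordinates turns the product measure into the one built from the other order of
    integration; both agree on rectangles, hence everywhere. *)
Lemma swap_preserving (A : set (T * T)) : measurable A ->
  nu2 ((fun z : T * T => (z.2, z.1)) @^-1` A) = nu2 A.
Proof.
move=> mA; rewrite [RHS](product_measure_unique (m' := (nu \x^ nu)%E))//.
by move=> B C mB mC; exact: product_measure2E.
Qed.

Lemma prod_map_preserving (t : T -> T) : measurable_fun setT t ->
  (forall A, measurable A -> nu (t @^-1` A) = nu A) ->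
  forall A : set (T * T), measurable A ->
  nu2 ((fun z : T * T => (t z.1, t z.2)) @^-1` A) = nu2 A.
Proof.
move=> mt pt A mA.
rewrite /product_measure1 /= -(ge0_integral_preserving mt pt (f := nu \o xsection A))//.
  apply: eq_integral => x _ /=.
  rewrite -(pt _ (measurable_xsection _ mA)); congr (nu _).
exact: measurable_fun_xsection.
Qed.

Lemma fst_preserving (A : set T) : measurable A -> nu2 (fst @^-1` A) = nu A.
Proof.
move=> mA; have -> : fst @^-1` A = A `*` [set: T].
  by apply/seteqP; split => z //= [].
rewrite product_measure1E// -[RHS]mule1; congr (_ * _)%E.
exact: probability_setT.
Qed.

Lemma ae_fst (P : T -> Prop) : {ae nu, forall x, P x} -> {ae nu2, forall z, P z.1}.
Proof. exact: (ae_preserving measurable_fst fst_preserving). Qed.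

Lemma ae_prod_map (t : T -> T) (P : T * T -> Prop) : measurable_fun setT t ->
  (forall A, measurable A -> nu (t @^-1` A) = nu A) ->
  {ae nu2, forall z, P z} -> {ae nu2, forall z, P (t z.1, t z.2)}.
Proof.
move=> mt pt; have mt2 : measurable_fun setT (fun z : T * T => (t z.1, t z.2)).
  apply/measurable_fun_pairP; split.
    exact: (measurableT_comp mt measurable_fst).
  exact: (measurableT_comp mt measurable_snd).
exact: (ae_preserving mt2 (prod_map_preserving mt pt)).
Qed.

Lemma ae_swap (P : T * T -> Prop) : {ae nu2, forall z, P z} ->
  {ae nu2, forall z, P (z.2, z.1)}.
Proof. exact: (ae_preserving measurable_swap swap_preserving). Qed.

Lemma ae_eq_sqint (f g : T * T -> R[i]) : cmeasurable f -> sqint nu2 g ->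
  {ae nu2, forall z, f z = g z} -> sqint nu2 f.
Proof.
move=> mf [mg /integrableP[mng ig]] fg; split => //; apply/integrableP.
have mnf : measurable_fun setT (EFin \o (fun z => normsq (f z))).
  by apply/measurable_EFinP; exact: measurable_normsq.
split => //; rewrite (ae_eq_integral (fun z => `|(normsq (g z))%:E|)%E)//.
- exact: measurableT_comp.
- exact: measurableT_comp.
- by apply: filterS fg => z fz _; rewrite /= fz.
Qed.

Lemma sqint_ess_le1 (f : T -> R[i]) : cmeasurable f -> (cLnorm nu +oo f <= 1)%E ->
  sqint nu f /\ nrm nu f <= 1.
Proof.
move=> mf f1; have aef : {ae nu, forall x, (normsq (f x) <= 1)}.
  (* The norm at [+oo] is the essential supremum only on a space of positive measure, which a
     probability provides. *)
  move: f1; rewrite /cLnorm unlock /= ifT; last first.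
    by rewrite [X in (_ < X)%E](probability_setT nu) lte01.
  move/ess_supP; apply: filterS => x /=.
  rewrite lee_fin => nf; rewrite -normcE2 -real_normK ?num_real//.
  by rewrite expr_le1.
have mn := measurable_normsq mf.
have mn' : measurable_fun setT (EFin \o (fun x => normsq (f x))) by exact/measurable_EFinP.
have nu1 : (\int[nu]_x (cst 1%E x) = 1 :> \bar R)%E.
  by rewrite integral_cst// mul1e; exact: probability_setT.
have I1 : (\int[nu]_x `|(normsq (f x))%:E| <= 1)%E.
  rewrite -nu1; apply: ae_ge0_le_integral => //.
  - exact: measurableT_comp.
  - by apply: filterS aef => x fx _; rewrite /= lee_fin ger0_norm ?normsq_ge0.
have sf : sqint nu f.
  by split => //; apply/integrableP; split => //; apply: le_lt_trans I1 _; rewrite ltry.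
split => //; rewrite -lee_fin /nrm /Rintegral fineK ?integrable_fin_num//; last by case: sf.
apply: le_trans I1; apply: ge0_le_integral => //.
- by move=> x _; rewrite lee_fin normsq_ge0.
- exact: measurableT_comp.
- by move=> x _; exact: lee_abs.
Qed.

Lemma sqint_cst_prod (c : R[i]) : sqint nu2 (fun=> c).
Proof. exact: (sqint_preserving measurable_fst fst_preserving (sqint_cst nu c)). Qed.

Lemma ip1_prod (f : T * T -> R[i]) : ip nu2 (fun=> 1) f = cintegral nu2 f.
Proof. by rewrite /ip; congr cintegral; apply/funext => z; rewrite conjc1 mul1r. Qed.

Lemma cintegral_cst_prod (c : R[i]) : cintegral nu2 (fun=> c) = c.
Proof.
rewrite (cintegral_preserving measurable_fst fst_preserving (cmeasurable_cst c)).
rewrite -[RHS](ip1_cst nu) /ip; congr cintegral; apply/funext => z.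
by rewrite conjc1 mul1r.
Qed.

(** The constant [p] is the orthogonal projection of [H] to the constants, so subtracting it lowers
    the squared norm by [normsq p]. It is real because swapping the variables conjugates [H] and
    preserves the integral; hence self-adjointness survives. *)
Lemma centered_kernel (H : T * T -> R[i]) : sqint nu2 H -> self_adjoint nu H ->
  let K := fun z => H z - mean nu H in
  [/\ sqint nu2 K, self_adjoint nu K, cintegral nu2 K = 0 & nrm nu2 K <= nrm nu2 H].
Proof.
move=> sH aH; set p := mean nu H => K.
have s1 := sqint_cst_prod 1; have sp := sqint_cst_prod p.
have sHs := sqint_preserving measurable_swap swap_preserving sH.
have iH : cintegrable nu2 H.
  have := sqint_cintegrable s1 sH.
  by under eq_fun do rewrite conjc1 mul1r.
have conj_p : conjc p = p.
  rewrite /p /mean -cintegralJ//.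
  rewrite -(cintegral_preserving measurable_swap swap_preserving (cmeasurableJ sH.1)).
  apply: ae_eq_cintegral; [exact: cmeasurableJ sHs.1|exact: sH.1|].
  by apply: filterS aH => z ->.
have Hp : cintegral nu2 H = p by [].
clearbody p; split; first exact: sqintB.
- by apply: filterS aH => z Hz; rewrite /K rmorphB /= conj_p -Hz.
- by rewrite -ip1_prod ipBr// !ip1_prod Hp cintegral_cst_prod subrr.
rewrite nrmB//.
have ipH c : ip nu2 H (fun=> c) = c * conjc p.
  have -> : (fun=> c) = (fun z => c * (fun=> 1) z) :> (T * T -> R[i]).
    by apply/funext => z; rewrite mulr1.
  by rewrite ipZr// (ipC s1 sH) ip1_prod Hp.
have -> : nrm nu2 (fun=> p) = normsq p.
  apply: (complexI (R := R)); rewrite -ip_nrm /ip -mul_conjc.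
  exact: cintegral_cst_prod.
rewrite ipH [p * _]mulrC mul_conjc /=; have := normsq_ge0 p; lra.
Qed.

(* Symmetrizing and cutting off the null set of bad rows turns an almost everywhere
   self-adjoint kernel into one for which every identity holds pointwise. *)
Lemma hermitian_modification (K : T * T -> R[i]) : sqint nu2 K -> self_adjoint nu K ->
  exists k, [/\ sqint nu2 k, forall x y, k (x, y) = conjc (k (y, x)),
    forall x, sqint nu (fun y => k (y, x)) & {ae nu2, forall z, k z = K z}].
Proof.
move=> sK aK; have [mK iK] := sK.
pose K' z := conjc (K (z.2, z.1)).
have mK' : cmeasurable K' by exact: cmeasurableJ (cmeasurable_swap mK).
pose L z := K z + K' z.
have mL : cmeasurable L by exact: cmeasurableD.
(* Bounding [K] and its transpose together lets a single set of good points control rows and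
   columns. *)
pose n2 z := normsq (K z) + normsq (K (z.2, z.1)).
have mn2 : measurable_fun setT (EFin \o n2).
  apply/measurable_EFinP; apply: measurable_funD; first exact: measurable_normsq.
  by apply: measurable_normsq; exact: cmeasurable_swap.
have i2 : nu2.-integrable setT (EFin \o n2).
  apply: rintegrableD => //.
  exact: (integrable_preserving measurable_swap swap_preserving iK).
have n20 z : (0 <= (EFin \o n2) z)%E by rewrite lee_fin addr_ge0// normsq_ge0.
pose N := [set x | fubini_F nu (EFin \o n2) x \is a fin_num].
have mF := measurable_fun_fubini_tonelli_F (m2 := nu) _ mn2 n20.
have mN : measurable N.
  by have := emeasurable_fin_num measurableT mF; rewrite setTI.
have aN : {ae nu, forall x, N x}.
  apply: filterS (ae_integrable1 i2) => x ix; rewrite /N /=.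
  exact: integrable_fin_num.
(* The factor one half averages [K] with its adjoint. The cutoff is applied in both variables to
   keep the kernel Hermitian. *)
pose k z : R[i] := ((\1_N z.1 * \1_N z.2) / 2 : R)%:C%C * L z.
have mk : cmeasurable k.
  apply: cmeasurableM => //; apply: cmeasurable_real.
  apply: measurable_funM => //; apply: measurable_funM.
    by apply: (measurableT_comp (measurable_indic mN)); exact: measurable_fst.
  by apply: (measurableT_comp (measurable_indic mN)); exact: measurable_snd.
have kK : {ae nu2, forall z, k z = K z}.
  apply: filterS3 (ae_fst aN) (ae_swap (ae_fst aN)) aK => z /= N1 N2 Kz.
  rewrite /k !indicE !mem_set// !mulr1 /L /K' -Kz.
  have -> : (1 / 2 : R)%:C%C = 2^-1 :> R[i].
    by rewrite mul1r -[LHS]/((real_complex R) 2^-1) fmorphV rmorph_nat.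
  by rewrite -mulr2n -[X in _ * X]mulr_natl mulrA mulVf ?mul1r// pnatr_eq0.
exists k; split => //.
- exact: ae_eq_sqint sK kK.
- move=> x y; rewrite /k conjcZ /L /K' /= rmorphD /= conjcK.
  by rewrite [_ + K (x, y)]addrC [\1_N y * _]mulrC.
- move=> x; have mkx : cmeasurable (fun y => k (y, x)) by exact: cmeasurable_pairr.
  have mKx : cmeasurable (fun y => K (x, y)) by exact: cmeasurable_pairl.
  (* At a bad point the cutoff makes the whole column zero; at a good point the finite row integral
     of [n2] dominates it. *)
  have [Nx|Nx] := pselect (N x); last first.
    have -> : (fun y => k (y, x)) = fun=> 0; last exact: sqint0.
    apply/funext => y; rewrite /k /= !indicE [x \in N]memNset//.
    by rewrite mulr0 mul0r mul0r.
  have in2 : nu.-integrable setT (EFin \o (fun y => n2 (x, y))).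
    apply/integrableP; split.
      exact: (measurableT_comp mn2 (measurable_pair1 x)).
    rewrite (eq_integral (fun y => (EFin \o n2) (x, y))); last first.
      by move=> y _; rewrite gee0_abs//; exact: n20.
    by move: Nx; rewrite /N /= fin_numElt => /andP[].
  split => //; apply: (le_rintegrable _ (rintegrableZ 2 in2)).
    exact: measurable_normsq.
  move=> y; rewrite ger0_norm ?normsq_ge0// /k normsqM normsqC.
  apply: (@le_trans _ _ (normsq (L (y, x)))).
    rewrite ler_piMl ?normsq_ge0//= !indicE expr_le1//.
    by rewrite -natrM; case: (y \in N); case: (x \in N) => /=; rewrite ?mul0r//; lra.
  by apply: le_trans (normsqD_le _ _) _; rewrite /K' /n2 /= normsqJ addrC.
Qed.

End ProductMaps.

(** * Irreducible subrepresentations *)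

Section Subrepresentation.
Context {R : realType} {G : topologicalGroupType}.

Definition ccontinuous (f : G -> R[i]) :=
  continuous (fun g => complex.Re (f g)) /\ continuous (fun g => complex.Im (f g)).

Lemma ccontinuousD f1 f2 : ccontinuous f1 -> ccontinuous f2 ->
  ccontinuous (fun g => f1 g + f2 g).
Proof.
move=> [a b] [c e]; split.
  by under eq_fun do rewrite ReD; move=> x; apply: cvgD; [exact: a|exact: c].
by under eq_fun do rewrite ImD; move=> x; apply: cvgD; [exact: b|exact: e].
Qed.

Lemma ccontinuousZ f c : ccontinuous f -> ccontinuous (fun g => c * f g).
Proof.
move=> [a b]; split.
  under eq_fun do rewrite ReM; move=> x.
  by apply: cvgB; (apply: cvgM; [exact: cvg_cst|]); [exact: a|exact: b].
under eq_fun do rewrite ImM; move=> x.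
by apply: cvgD; (apply: cvgM; [exact: cvg_cst|]); [exact: b|exact: a].
Qed.

Lemma ccontinuous_sum n (f : 'I_n -> G -> R[i]) : (forall i, ccontinuous (f i)) ->
  ccontinuous (fun g => \sum_(i < n) f i g).
Proof.
move=> cf; elim: (index_enum _) => [|i s IH].
  by under eq_fun do rewrite big_nil; split => x; exact: cvg_cst.
by under eq_fun do rewrite big_cons; exact: ccontinuousD.
Qed.

(** A nonzero invariant subspace [W] of least dimension is irreducible. The columns of [B] are a
    basis of [W], and [rho'] is the action on [W] in coordinates. *)
Lemma irreducible_subrepresentation n (rho : G -> 'M[R[i]]_n) :
  (0 < n)%N -> representation rho ->
  exists m (B : 'M[R[i]]_(n, m)) (rho' : G -> 'M[R[i]]_m),
    [/\ (m <= n)%N, representation rho', irreducible rho',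
        forall g, B *m rho' g = rho g *m B &
        forall v : 'cV_m, B *m v = 0 -> v = 0].
Proof.
move=> n0 [rho1 rhoM rhoC].
pose inv (W : {vspace 'cV[R[i]]_n}) := forall g v, v \in W -> rho g *m v \in W.
pose P m := `[< exists W : {vspace 'cV[R[i]]_n}, [/\ inv W, W != 0%VS & \dim W = m] >].
have dimT p : \dim (fullv : {vspace 'cV[R[i]]_p}) = p by rewrite dimvf /dim /= muln1.
have Pn : P n.
  apply/asboolP; exists fullv; split; [by move=> *; exact: memvf| |exact: dimT].
  by rewrite -dimv_eq0 dimT -lt0n.
case: (ex_minnP (ex_intro _ n Pn)) => m /asboolP[W [invW W0 dW]] min_m.
subst m; pose m := \dim W; pose b := vbasis W.
have bW : basis_of W b by exact: vbasisP.
have fb : free b by exact: basis_free bW.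
have memb (i : 'I_m) : b`_i \in W by apply: vbasis_mem; apply: mem_nth; rewrite size_tuple.
pose B : 'M[R[i]]_(n, m) := \matrix_(i, j) (b`_j) i 0.
have BE (v : 'cV[R[i]]_m) : B *m v = \sum_(j < m) v j 0 *: b`_j.
  apply/colP => i; rewrite mxE summxE; apply: eq_bigr => j _.
  by rewrite !mxE mulrC.
have Binj (v : 'cV[R[i]]_m) : B *m v = 0 -> v = 0.
  move=> Bv; apply/colP => i; rewrite mxE; move: i.
  by have /freeP H := fb; apply: (H (fun j => v j 0)); rewrite -BE.
have BinjM p (X Y : 'M[R[i]]_(m, p)) : B *m X = B *m Y -> X = Y.
  move=> /eqP; rewrite -subr_eq0 -mulmxBr => /eqP BXY.
  apply/eqP; rewrite -subr_eq0; apply/eqP/matrixP => i j.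
  have := Binj (col j (X - Y)); rewrite colE mulmxA BXY mul0mx => /(_ erefl).
  by move=> /colP/(_ i); rewrite -colE !mxE.
pose rho' g : 'M[R[i]]_m := \matrix_(i, j) coord b i (rho g *m b`_j).
have Brho g : B *m rho' g = rho g *m B.
  apply/matrixP => i j; have := coord_vbasis (invW g _ (memb j)).
  move=> /colP/(_ i); rewrite [in X in X -> _]mxE => H.
  rewrite !mxE (eq_bigr (fun l => rho g i l * (b`_j) l 0)); last first.
    by move=> l _; rewrite mxE.
  rewrite H summxE; apply: eq_bigr => l _.
  by rewrite !mxE mulrC.
exists m, B, rho'; split => //.
- by rewrite -[X in (_ <= X)%N]dimT dimvS// subvf.
- split.
  + by apply: BinjM; rewrite Brho rho1 mul1mx mulmx1.
  + move=> g h; apply: BinjM.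
    by rewrite Brho rhoM mulmxA Brho -mulmxA -Brho mulmxA.
  + move=> i j.
    (* The entries of [rho'] are linear combinations of those of [rho] with coefficients independent
       of [g], which gives continuity. *)
    have -> : (fun g => complex.Re (rho' g i j)) = (fun g => complex.Re
       (\sum_(l < n) coord b i (delta_mx l 0) * (\sum_(p < n) (b`_j) p 0 * rho g l p))).
      apply/funext => g; congr complex.Re; rewrite mxE.
      rewrite [X in coord _ _ X]matrix_sum_delta linear_sum; apply: eq_bigr => l _.
      rewrite big_ord1 linearZ /= mulrC mxE; congr (_ * _).
      by apply: eq_bigr => p _; rewrite mulrC.
    have -> : (fun g => complex.Im (rho' g i j)) = (fun g => complex.Im
       (\sum_(l < n) coord b i (delta_mx l 0) * (\sum_(p < n) (b`_j) p 0 * rho g l p))).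
      apply/funext => g; congr complex.Im; rewrite mxE.
      rewrite [X in coord _ _ X]matrix_sum_delta linear_sum; apply: eq_bigr => l _.
      rewrite big_ord1 linearZ /= mulrC mxE; congr (_ * _).
      by apply: eq_bigr => p _; rewrite mulrC.
    apply: ccontinuous_sum => l; apply: ccontinuousZ; apply: ccontinuous_sum => p.
    by apply: ccontinuousZ; exact: rhoC.
- split; first by rewrite lt0n dimv_eq0.
  move=> W' invW'; have [->|W'0] := eqVneq W' 0%VS; [by left|right].
  (* The image of [W'] under [B] is a nonzero invariant subspace of the same dimension, so
     minimality forces [W'] to have full dimension [m]. *)
  pose f := linfun (mulmx B : 'cV[R[i]]_m -> 'cV[R[i]]_n).
  have kf : (W' :&: lker f)%VS = 0%VS.
    apply/eqP; rewrite -subv0; apply/subvP => v.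
    by rewrite memv_cap memv_ker lfunE /= => /andP[_ /eqP/Binj ->]; exact: mem0v.
  apply/eqP; rewrite eqEdim subvf dimT /=.
  apply: min_m; apply/asboolP; exists (f @: W')%VS; split.
  + move=> g _ /memv_imgP[v vW ->]; rewrite lfunE /= mulmxA -Brho -mulmxA.
    by rewrite -[B *m _]/(mulmx B (rho' g *m v)) -(lfunE (mulmx B)) memv_img ?invW'.
  + by rewrite -dimv_eq0 limg_dim_eq// dimv_eq0.
  + exact: limg_dim_eq.
Qed.

End Subrepresentation.

(** * Eigenspaces of Hermitian kernels *)

Section HermitianKernel.
Context {d : measure_display} {T : measurableType d} {R : realType}.
Variable nu : probability T R.
Local Notation nu2 := (nu \x nu)%E.
Variable k : T * T -> R[i].
Hypothesis sk : sqint nu2 k.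
Hypothesis k_herm : forall x y, k (x, y) = conjc (k (y, x)).
Hypothesis k_col : forall x, sqint nu (fun y => k (y, x)).
Implicit Types f g : T -> R[i].

Local Notation col x := (fun y => k (y, x)).

Lemma kopE f x : kop nu k f x = cintegral nu (fun y => k (x, y) * f y).
Proof. by []. Qed.

Lemma kop_ip f x : kop nu k f x = ip nu (col x) f.
Proof. by apply: eq_cintegral => y; rewrite -k_herm. Qed.

Lemma cintegrable_row f x : sqint nu f -> cintegrable nu (fun y => k (x, y) * f y).
Proof.
move=> sf; have := sqint_cintegrable (k_col x) sf.
by under eq_fun do rewrite -k_herm.
Qed.

Lemma normsq_kop_le f x : sqint nu f ->
  normsq (kop nu k f x) <= nrm nu (col x) * nrm nu f.
Proof. by move=> sf; rewrite kop_ip; exact: cauchy_schwarz. Qed.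

(** This function of [x] dominates the pointwise estimates on [A f] below. Fubini yields it for
    rows, and Hermitian symmetry turns rows into columns. *)
Lemma nrm_col_integrable :
  nu.-integrable setT (EFin \o (fun x => nrm nu (col x))) /\
  (\int[nu]_x nrm nu (col x) = nrm nu2 k)%R.
Proof.
have [mk ik] := sk; split; last by rewrite [RHS]/nrm (Rfubini ik).2.
have := integrable_fubini_F ik; apply: eq_integrable => // x _.
rewrite /fubini_F /= /nrm /Rintegral.
rewrite fineK; last by have [_ i] := k_col x; exact: (integrable_fin_num _ i).
by apply: eq_integral => y _; rewrite k_herm normsqJ.
Qed.

Lemma sqint_kop f : sqint nu f -> sqint nu (kop nu k f).
Proof.
move=> sf; have [mf _] := sf; have [mk _] := sk.
have mkf := cmeasurable_kop nu mk mf; split => //.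
apply: (le_rintegrable _ (rintegrableZ (nrm nu f) nrm_col_integrable.1)).
  exact: measurable_normsq.
by move=> x; rewrite ger0_norm ?normsq_ge0// mulrC normsq_kop_le.
Qed.

Lemma nrm_kop_le f : sqint nu f -> nrm nu (kop nu k f) <= nrm nu2 k * nrm nu f.
Proof.
move=> sf; have [_ i] := sqint_kop sf; have [j <-] := nrm_col_integrable.
rewrite mulrC -RintegralZl//; apply: le_Rintegral => //.
  exact: rintegrableZ.
by move=> x _; rewrite mulrC normsq_kop_le.
Qed.

Lemma kop_form f g : sqint nu f -> sqint nu g ->
  cintegral nu2 (fun z => conjc (f z.1) * k z * g z.2) = ip nu f (kop nu k g).
Proof.
move=> sf sg; have [-> _] := cfubini (sqint_kernelM sk sf sg).
apply: eq_cintegral => x; rewrite /= -cintegralZ; last exact: cintegrable_row.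
by apply: eq_cintegral => y; rewrite mulrA.
Qed.

Lemma kop_adjoint f g : sqint nu f -> sqint nu g ->
  ip nu (kop nu k f) g = ip nu f (kop nu k g).
Proof.
move=> sf sg; rewrite -kop_form//.
have [_ ->] := cfubini (sqint_kernelM sk sf sg).
apply: eq_cintegral => y; rewrite /kop -cintegralJ; last exact: cintegrable_row.
rewrite mulrC -cintegralZ; last first.
  have := sqint_cintegrable sf (k_col y).
  by under eq_fun => x do rewrite mulrC k_herm -rmorphM /=.
by apply: eq_cintegral => x; rewrite rmorphM /= -k_herm; ring.
Qed.

(* Bessel's inequality for the columns of the kernel, integrated. *)
Lemma sum_nrm_kop_le n (e : 'I_n -> T -> R[i]) : (forall i, sqint nu (e i)) ->
  (forall i j, ip nu (e i) (e j) = (i == j)%:R) ->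
  \sum_(i < n) nrm nu (kop nu k (e i)) <= nrm nu2 k.
Proof.
move=> se oe; have [j <-] := nrm_col_integrable.
have I (s : seq 'I_n) :
  nu.-integrable setT (EFin \o (fun x => \sum_(i <- s) normsq (kop nu k (e i) x))) /\
  \sum_(i <- s) nrm nu (kop nu k (e i)) =
    (\int[nu]_x (\sum_(i <- s) normsq (kop nu k (e i) x)))%R.
  elim: s => [|i s [IH1 IH2]].
    rewrite big_nil; split.
      by under [_ \o _]eq_fun do rewrite /= big_nil; exact: (integrable0 _ setT).
    by under eq_Rintegral do rewrite big_nil; rewrite /Rintegral integral0.
  have [_ ii] := sqint_kop (se i).
  rewrite big_cons IH2; split.
    by under [_ \o _]eq_fun do rewrite /= big_cons; exact: rintegrableD.
  by under [RHS]eq_Rintegral do rewrite big_cons; rewrite RintegralD.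
have [i1 ->] := I (index_enum 'I_n).
apply: le_Rintegral => // x _.
have sc c : sqint nu (fun y => \sum_(i < n) c i * e i y) by exact: sqint_sum.
(* These are the Fourier coefficients of the column at [x], equal up to conjugation to the values of
   [kop nu k (e i)] at [x]. Bessel is the nonnegativity of the squared norm of the remainder. *)
pose c i := ip nu (e i) (col x).
have := nrm_ge0 nu (fun y => k (y, x) - \sum_(i < n) c i * e i y).
have E1 i : ip nu (e i) (fun y => \sum_(j < n) c j * e j y) = c i.
  rewrite ip_sumr// (bigD1 i)//= oe eqxx mulr1 big1 ?addr0// => l li.
  by rewrite oe eq_sym (negbTE li) mulr0.
have E2 g : sqint nu g -> ip nu g (fun y => \sum_(j < n) c j * e j y) =
   \sum_(j < n) c j * ip nu g (e j) by move=> sg; rewrite ip_sumr.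
have N i : normsq (kop nu k (e i) x) = normsq (c i).
  by rewrite kop_ip (ipC (se i) (k_col x)) normsqJ.
rewrite (eq_bigr _ (fun i _ => N i)).
have S1 : ip nu (col x) (fun y => \sum_(j < n) c j * e j y) =
   (\sum_i normsq (c i))%:C%C.
  rewrite E2// rmorph_sum /=; apply: eq_bigr => i _.
  by rewrite (ipC (se i) (k_col x)) mulrC mul_conjc.
have S2 : ip nu (fun y => \sum_(j < n) c j * e j y)
     (fun y => \sum_(j < n) c j * e j y) = (\sum_i normsq (c i))%:C%C.
  rewrite E2// rmorph_sum /=; apply: eq_bigr => i _.
  by rewrite (ipC (se i) (sc c)) E1 mulrC mul_conjc.
rewrite nrmB// S1 /=.
move: S2; rewrite ip_nrm => /complexI ->.
set a := nrm _ _; set b := \sum_(_ < _) _; lra.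
Qed.


(** * Iterates of the operator and attainment of its norm *)

Local Notation A := (kop nu k).

Lemma sqint_iter f n : sqint nu f -> sqint nu (iter n A f).
Proof. by move=> sf; elim: n => //= n IH; exact: sqint_kop. Qed.

Lemma ip_iter f g i j : sqint nu f -> sqint nu g ->
  ip nu (iter i A f) (iter j A g) = ip nu f (iter (i + j) A g).
Proof.
move=> sf sg; elim: i j => // i IH j.
rewrite iterS kop_adjoint; try exact: sqint_iter.
by rewrite -iterS IH addnS addSn.
Qed.

(** Moving one factor [A] across the inner product writes the squared norm of the middle iterate as
    the inner product of its two neighbours. *)
Lemma nrm_iter_logconvex f n : sqint nu f ->
  nrm nu (iter n.+1 A f) ^+ 2 <= nrm nu (iter n A f) * nrm nu (iter n.+2 A f).
Proof.
move=> sf; rewrite -normsqC -ip_nrm ip_iter// addSnnS -ip_iter//.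
by apply: cauchy_schwarz; exact: sqint_iter.
Qed.

(** By log-convexity the ratios of consecutive squared norms do not decrease, so the lower bound
    [rho] on the first ratio holds for all. *)
Lemma nrm_iter_ge f (rho : R) n : sqint nu f -> 0 < rho -> 0 < nrm nu f ->
  rho * nrm nu f <= nrm nu (A f) -> rho ^+ n * nrm nu f <= nrm nu (iter n A f).
Proof.
move=> sf r0 f0 fA.
have H m : 0 < nrm nu (iter m A f) /\
    rho * nrm nu (iter m A f) <= nrm nu (iter m.+1 A f).
  elim: m => [//|m [a0 ra]].
  have b0 : 0 < nrm nu (iter m.+1 A f) by apply: lt_le_trans ra; exact: mulr_gt0.
  split; first exact: b0.
  move: (nrm_iter_logconvex m sf) ra a0 b0.
  move: (nrm nu (iter m A f)) (nrm nu (iter m.+1 A f)) (nrm nu (iter m.+2 A f)).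
  move=> a b c bac ab a0 b0; rewrite -(ler_pM2l a0); apply: le_trans bac.
  by rewrite mulrA [a * rho]mulrC expr2 ler_pM2r.
elim: n => [|n IH]; first by rewrite mul1r.
by rewrite exprS -mulrA; apply: le_trans (H n).2; rewrite ler_pM2l.
Qed.

(** The square of the operator norm of [A], since [nrm] is a squared norm. *)
Definition opnorm2 := sup [set nrm nu (A f) | f in [set f | sqint nu f /\ nrm nu f <= 1]].

Lemma has_sup_opnorm2 :
  has_sup [set nrm nu (A f) | f in [set f | sqint nu f /\ nrm nu f <= 1]].
Proof.
split.
  exists (nrm nu (A (fun=> 0))); exists (fun=> 0) => //; split; first exact: sqint0.
  rewrite /nrm (_ : (fun=> _) = (fun=> 0)) ?Rintegral_cst// ?mul0r ?ler01//.
  by apply/funext => x; rewrite /normsq /= expr0n /= addr0.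
exists (nrm nu2 k) => _ [f [sf f1] <-].
apply: le_trans (nrm_kop_le sf) _.
by rewrite ler_piMr// nrm_ge0.
Qed.

Lemma opnorm2_ge f : sqint nu f -> nrm nu f <= 1 -> nrm nu (A f) <= opnorm2.
Proof.
by move=> sf f1; apply: ub_le_sup; [exact: has_sup_opnorm2.2|exists f].
Qed.

Lemma kopZ f c x : sqint nu f -> A (fun y => c * f y) x = c * A f x.
Proof.
move=> sf; rewrite /kop -cintegralZ; last exact: cintegrable_row.
by apply: eq_cintegral => y; rewrite mulrCA.
Qed.

Lemma nrm_kop_opnorm2 f : sqint nu f -> nrm nu (A f) <= opnorm2 * nrm nu f.
Proof.
move=> sf; have [f0|] := eqVneq (nrm nu f) 0.
  by have := nrm_kop_le sf; rewrite f0 !mulr0.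
rewrite neq_lt ltNge nrm_ge0 /= => f0.
pose c : R[i] := ((Num.sqrt (nrm nu f))^-1)%:C%C.
have c2 : normsq c = (nrm nu f)^-1.
  by rewrite normsqC exprVn sqr_sqrtr// ltW.
have sc : sqint nu (fun y => c * f y) by exact: sqintZ.
have := opnorm2_ge sc; rewrite nrmZ// c2 mulVf ?gt_eqF// => /(_ (lexx _)).
rewrite (_ : A _ = (fun x => c * A f x)); last by apply/funext => x; rewrite kopZ.
rewrite nrmZ ?c2; last exact: sqint_kop.
by rewrite ler_pdivrMl// mulrC.
Qed.

(** Take [h] in the unit ball with [nrm (A h)] above [s t], where [t = 1 - 1 / (2 (n + 1))]. Then
    [nrm h] is itself at least [t], and [nrm_iter_ge] gives [(s t)^n * t = s^n * t^(n + 1)], which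
    is at least [s^n / 2]. *)
Lemma opnorm2_approx n : 0 < opnorm2 -> exists h,
  [/\ sqint nu h, nrm nu h <= 1 & opnorm2 ^+ n / 2 <= nrm nu (iter n A h)].
Proof.
move=> s0; set s := opnorm2; pose t := 1 - (2 * n.+1%:R)^-1 : R.
have u0 : 0 < (2 * n.+1%:R : R)^-1 by rewrite invr_gt0 mulr_gt0.
have [_ [h [sh h1] <-]] := sup_adherent (mulr_gt0 s0 u0) has_sup_opnorm2.
rewrite -/opnorm2 -/s => hs; exists h; split => //.
have t0 : 0 < t.
  rewrite subr_gt0 invf_lt1 ?mulr_gt0//.
  by rewrite -natrM ltr1n mulnS.
have ts0 : 0 < s * t by exact: mulr_gt0.
have {}hs : s * t <= nrm nu (A h) by rewrite mulrBr mulr1 ltW.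
have th : t <= nrm nu h.
  by have := le_trans hs (nrm_kop_opnorm2 sh); rewrite ler_pM2l.
have h0 := lt_le_trans t0 th.
have := nrm_iter_ge n sh ts0 h0; rewrite -/s.
move=> H; apply: le_trans (H _); last first.
  by apply: le_trans hs; rewrite ler_piMr// ltW.
rewrite exprMn -mulrA ler_pM2l ?exprn_gt0//.
apply: le_trans (bernoulli_half n) _; rewrite -/t exprSr.
by rewrite ler_pM2l ?exprn_gt0.
Qed.

(** The near-maximizer [h_ n] is chosen anew for each [n]. The functions [phi n] would tend to 0
    pointwise under an integrable bound, although each has integral at least one half. *)
Lemma nrm_col_not_cvg0 : 0 < opnorm2 ->
  exists y, ~ (fun n => opnorm2 ^- n * nrm nu (iter n A (col y))) @ \oo --> (0 : R).
Proof.
move=> s0; apply: contrapT => /forallNP b0.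
have {}b0 y : (fun n => opnorm2 ^- n * nrm nu (iter n A (col y))) @ \oo --> (0 : R).
  exact: contrapT (b0 y).
move: b0; set s := opnorm2 => b0.
have /boolp.choice[h_ Hh] : forall n, exists h,
  [/\ sqint nu h, nrm nu h <= 1 & s ^+ n.+1 / 2 <= nrm nu (iter n.+1 A h)].
  by move=> n; exact: opnorm2_approx.
have sn0 n : 0 < s ^- n by rewrite invr_gt0 exprn_gt0.
pose phi n y := s ^- n.+1 * normsq (iter n.+1 A (h_ n) y).
(* The value of [A^(n+1) h] at [y] is the inner product of the column with [A^n h]; self-adjointness
   moves all [n] factors to the column. *)
have phi_le n y : phi n y <= s^-1 * (s ^- n * nrm nu (iter n A (col y))).
  have [sh h1 _] := Hh n.
  rewrite /phi mulrA -invfM -exprS ler_pM2l// iterS kop_ip.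
  rewrite -(ip_iter 0 n)//= -[X in normsq (ip _ X _)]/(iter 0 A (col y)).
  rewrite ip_iter// addnC -ip_iter//=.
  apply: le_trans (cauchy_schwarz (sqint_iter n (k_col y)) sh) _.
  by rewrite ler_piMr// nrm_ge0.
have phi0 n y : 0 <= phi n y by rewrite mulr_ge0 ?normsq_ge0 ?ltW.
(* Each application of [A] multiplies the squared norm by at most [s]; so the column norms at
   [n = 0] dominate. *)
have bdec n y : s ^- n * nrm nu (iter n A (col y)) <= nrm nu (col y).
  elim: n => [|n IH]; first by rewrite expr0 invr1 mul1r.
  apply: le_trans IH.
  rewrite exprSr invfM -mulrA ler_pM2l// ler_pdivrMl// iterS.
  exact: nrm_kop_opnorm2 (sqint_iter n (k_col y)).
have mphi n : measurable_fun setT (phi n).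
  apply: measurable_funM => //; apply: measurable_normsq.
  by have [sh _ _] := Hh n; have [] := sqint_iter n.+1 sh.
have := @dominated_convergence _ _ _ nu setT measurableT
  (fun n x => (phi n x)%:E) (cst 0%E) (fun x => (s^-1 * nrm nu (col x))%:E).
case.
- by move=> n; exact/measurable_EFinP.
- exact: measurable_cst.
- apply: aeW => y _; apply: cvg_EFin; first exact: nearW.
  apply: (@squeeze_cvgr _ _ _ _ (cst 0)
    (fun n => s^-1 * (s ^- n * nrm nu (iter n A (col y))))).
  + by apply: nearW => n; rewrite phi0 phi_le.
  + exact: cvg_cst.
  + by rewrite -(mulr0 s^-1); apply: cvgM (b0 y); exact: cvg_cst.
- by apply: rintegrableZ; exact: nrm_col_integrable.1.
- apply: aeW => y n _; rewrite /= lee_fin ger0_norm//.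
  by apply: le_trans (phi_le n y) _; rewrite ler_pM2l ?invr_gt0.
move=> _ _; rewrite integral0 => I0.
have : (2^-1%:E <= 0 :> \bar R)%E.
  apply: (cvge_ge _ I0); apply: nearW => n.
  have [sh _ hn] := Hh n; have [_ ih] := sqint_iter n.+1 sh.
  rewrite /= (_ : (\int[nu]_x (phi n x)%:E)%E =
     (s ^- n.+1 * nrm nu (iter n.+1 A (h_ n)))%:E).
    by rewrite lee_fin ler_pdivlMl ?exprn_gt0.
  rewrite /nrm -RintegralZl// /Rintegral fineK//.
  by apply: integrable_fin_num => //; exact: rintegrableZ.
by rewrite lee_fin leNgt invr_gt0 ltr0n.
Qed.

Lemma opnorm2_eigenvector : 0 < opnorm2 -> exists w,
  [/\ sqint nu w, nrm nu w != 0 &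
      forall h, sqint nu h -> ip nu (A (A h)) w = opnorm2%:C%C * ip nu h w].
Proof.
move=> s0; have [y0] := nrm_col_not_cvg0 s0.
set s := opnorm2 in s0 *; set v := (fun x => k (x, y0)).
have sv : sqint nu v by exact: k_col.
have si n : sqint nu (iter n A v) by exact: sqint_iter.
pose b n := s ^- n * nrm nu (iter n A v).
rewrite -/(b : R^nat) => bN0.
have sn0 n : 0 < s ^- n by rewrite invr_gt0 exprn_gt0.
have sS n : s ^- n = s * s ^- n.+1.
  by rewrite exprS invfM mulrA divff ?mul1r//; exact: lt0r_neq0.
have b_ge0 n : 0 <= b n by rewrite mulr_ge0 ?nrm_ge0// ltW.
have bdecS n : b n.+1 <= b n.
  rewrite /b exprSr invfM -mulrA ler_pM2l// ler_pdivrMl// iterS.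
  exact: nrm_kop_opnorm2.
have bdec : {homo b : n m / (n <= m)%N >-> m <= n}.
  exact/nonincreasing_seqP.
have cb : cvgn b.
  by apply: nonincreasing_is_cvgn => //; exists 0 => _ [n _ <-].
pose l : R := limn b.
have lb n : l <= b n by exact: nonincreasing_cvgn_ge.
have l0 : 0 < l.
  rewrite lt_neqAle; apply/andP; split; last by apply: limr_ge => //; exact: nearW.
  by apply/eqP => l0; apply: bN0; rewrite [X in _ --> X]l0; exact: cb.
(* The squared distance of [u n] and [u m] is [b (n + n) + b (m + m) - 2 b (n + m)]. For [n <= m],
   monotonicity of [b] bounds it by [b (n + n) - l]. *)
pose eps n := b (n + n)%N - l.
have eps0 : eps @ \oo --> (0 : R).
  rewrite -(subrr l); apply: cvgB; last exact: cvg_cst.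
  apply: (@squeeze_cvgr _ _ _ _ (cst l) b).
  - by apply: nearW => n; rewrite lb bdec// leq_addr.
  - exact: cvg_cst.
  - exact: cb.
pose u n x := (s ^- n)%:C%C * iter (n + n) A v x.
have su n : sqint nu (u n) by exact: sqintZ.
have nu_ n m : (n <= m)%N -> nrm nu (fun x => u n x - u m x) <= eps n.
  have sZ c i : sqint nu (fun x => c * iter i A v x) by exact: sqintZ.
  move=> nm; rewrite nrmB// /u !nrmZ// ipZl// ipZr// conjc_real.
  rewrite ip_iter// addnACA -ip_iter// ip_nrm !normsqC.
  rewrite -!rmorphM /=.
  have E i : (s ^- i) ^+ 2 = s ^- (i + i) by rewrite expr2 -invfM -exprD.
  have E' : s ^- n * (s ^- m * nrm nu (iter (n + m) A v)) = b (n + m)%N.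
    by rewrite /b mulrA -invfM -exprD addnC.
  rewrite !E E' -/(b (n + n)%N) -/(b (m + m)%N) /eps.
  have := lb (n + m)%N; have := bdec (n + m)%N (m + m)%N; rewrite leq_add2r => /(_ nm).
  by clearbody l; move: (b (m + m)%N) (b (n + m)%N) (b (n + n)%N) => x y z *; lra.
(* One more application of [A] turns the L_2 Cauchy property into a pointwise one, with rate [eps n]
   times the squared column norm. The limit is then taken point by point. *)
pose wn n x := A (u n) x.
have swn n : sqint nu (wn n) by exact: sqint_kop.
pose q x := nrm nu (fun y => k (y, x)).
have wnB n m x : (n <= m)%N -> normsq (wn n x - wn m x) <= q x * eps n.
  move=> nm; rewrite /wn !kop_ip -ipBr//.
  apply: le_trans (cauchy_schwarz _ _) _ => //; first exact: sqintB.
  by rewrite ler_wpM2l ?nrm_ge0// nu_.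
have qe0 x : (fun n => q x * eps n) @ \oo --> (0 : R).
  by rewrite -(mulr0 (q x)); apply: cvgM => //; exact: cvg_cst.
have cRe x := cauchy_sqr_cvg (r := fun n => complex.Re (wn n x)) (qe0 x).
have cIm x := cauchy_sqr_cvg (r := fun n => complex.Im (wn n x)) (qe0 x).
have {}cRe x : cvgn (fun n => complex.Re (wn n x)) /\ forall n,
    (complex.Re (wn n x) - limn (fun n => complex.Re (wn n x))) ^+ 2 <= q x * eps n.
  apply: cRe => n m /wnB - /(_ x); apply: le_trans.
  by rewrite /normsq !ReImE lerDl sqr_ge0.
have {}cIm x : cvgn (fun n => complex.Im (wn n x)) /\ forall n,
    (complex.Im (wn n x) - limn (fun n => complex.Im (wn n x))) ^+ 2 <= q x * eps n.
  apply: cIm => n m /wnB - /(_ x); apply: le_trans.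
  by rewrite /normsq !ReImE lerDr sqr_ge0.
pose w x := Complex (limn (fun n => complex.Re (wn n x)))
                    (limn (fun n => complex.Im (wn n x))).
have mw : cmeasurable w.
  split.
    apply: (measurable_fun_cvg (h := fun n x => complex.Re (wn n x))).
      by move=> n; have [[]] := swn n.
    by move=> x _; exact: (cRe x).1.
  apply: (measurable_fun_cvg (h := fun n x => complex.Im (wn n x))).
    by move=> n; have [[]] := swn n.
  by move=> x _; exact: (cIm x).1.
have wB n x : normsq (wn n x - w x) <= (2 * eps n) * q x.
  rewrite /normsq !ReImE /=; have := (cRe x).2 n; have := (cIm x).2 n.
  move=> h1 h2; apply: le_trans (lerD h2 h1) _.
  suff -> : 2 * eps n * q x = q x * eps n + q x * eps n by [].
  by move: (eps n) (q x) => a c; ring.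
have mB n : cmeasurable (fun x => wn n x - w x).
  by apply: cmeasurableD; [case: (swn n)|exact: cmeasurableN].
have [iq Iq] := nrm_col_integrable.
have sB n : sqint nu (fun x => wn n x - w x).
  split => //; apply: (le_rintegrable _ (rintegrableZ (2 * eps n) iq)).
    exact: measurable_normsq.
  by move=> x; rewrite ger0_norm ?normsq_ge0//; exact: wB.
pose Q := nrm nu2 k.
have nB n : nrm nu (fun x => wn n x - w x) <= 2 * Q * eps n.
  rewrite mulrAC /Q -Iq -RintegralZl//; have [_ i] := sB n.
  by apply: le_Rintegral => //; exact: rintegrableZ.
have sw : sqint nu w.
  have -> : w = (fun x => wn 0 x - (wn 0 x - w x)).
    by apply/funext => x; rewrite opprB addrCA subrr addr0.
  exact: sqintB.
have wnE n : wn n = (fun x => (s ^- n)%:C%C * iter (n + n).+1 A v x).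
  by apply/funext => x; rewrite /wn /u kopZ.
have nwn n : nrm nu (wn n) = s * b (n + n).+1.
  rewrite wnE nrmZ// normsqC /b expr2 -invfM -exprD exprS invfM.
  by rewrite !mulrA divff ?gt_eqF// mul1r.
exists w; split => //.
  apply/eqP => w0.
  (* The squared norm of [wn n] stays above [s * l], while its squared distance from [w] tends to 0;
     a null [w] would force [s * l] to be nonpositive. *)
  have : s * l <= 0.
    apply: (@le0_of_cvg0 _ _ (2 * (2 * Q)) _ eps0) => n.
    apply: (@le_trans _ _ (nrm nu (wn n))); first by rewrite nwn ler_pM2l.
    have -> : wn n = (fun x => (wn n x - w x) + w x).
      by apply/funext => x; rewrite subrK.
    apply: le_trans (nrmD_le _ _) _ => //.
    by rewrite w0 addr0 -mulrA ler_pM2l.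
  by rewrite leNgt mulr_gt0.
move=> h sh; apply/eqP; rewrite -subr_eq0; apply/eqP/normsq_eq0/eqP.
rewrite eq_le normsq_ge0 andbT.
have sAAh : sqint nu (A (A h)) by do 2 apply: sqint_kop.
(* Applying [A] twice to [wn n] gives [s] times [wn n.+1]. The eigenvalue equation follows in the
   limit. *)
have wS n : ip nu (A (A h)) (wn n) = s%:C%C * ip nu h (wn n.+1).
  have X : ip nu (A (A h)) (iter (n + n).+1 A v) =
      ip nu h (iter (n.+1 + n.+1).+1 A v).
    have -> : (n.+1 + n.+1).+1 = (2 + (n + n).+1)%N by rewrite !addnS !addSn.
    exact: (ip_iter 2 _ sh sv).
  rewrite (wnE n) (wnE n.+1) (ipZr _ sAAh (si _)) (ipZr _ sh (si _)) X.
  by move: (ip nu h _) => z; rewrite sS rmorphM -mulrA.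
pose D := nrm nu (A (A h)); pose E := nrm nu h.
(* The outer 2 is from [normsqD_le], [D] and [E] from Cauchy-Schwarz, and each [2 * Q] from [nB],
   the second time at [n.+1] with [eps n.+1 <= eps n]. *)
apply: (@le0_of_cvg0 _ _ (2 * (D * (2 * Q) + s ^+ 2 * (E * (2 * Q)))) _ eps0) => n.
have -> : ip nu (A (A h)) w - s%:C%C * ip nu h w =
  - ip nu (A (A h)) (fun x => wn n x - w x) +
  s%:C%C * ip nu h (fun x => wn n.+1 x - w x).
  by rewrite !ipBr// wS; ring.
apply: le_trans (normsqD_le _ _) _; rewrite -mulrA ler_pM2l// normsqN normsqM normsqC.
rewrite mulrDl; apply: lerD.
  apply: le_trans (cauchy_schwarz _ _) _ => //.
  by rewrite -mulrA ler_wpM2l ?nrm_ge0.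
rewrite -[leRHS]mulrA ler_wpM2l ?sqr_ge0//.
apply: le_trans (cauchy_schwarz _ _) _ => //.
rewrite -[leRHS]mulrA ler_wpM2l ?nrm_ge0//; apply: le_trans (nB _) _.
rewrite ler_wpM2l ?mulr_ge0 ?nrm_ge0// lerB// bdec//.
by rewrite leq_add.
Qed.

(* Unification would otherwise compare integrals by unfolding them. *)
Local Opaque kop ip nrm.

(** The eigenspace of the square of [A] in weak form: as [A] is self-adjoint, the condition says
    that [A (A f)] equals [opnorm2] times [f] almost everywhere. *)
Definition eigensp f := sqint nu f /\
  forall h, sqint nu h -> ip nu (A (A h)) f = opnorm2%:C%C * ip nu h f.

Lemma eigenspZ f c : eigensp f -> eigensp (fun x => c * f x).
Proof.
move=> [sf ef]; split; first exact: sqintZ.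
move=> h sh; have sAAh := sqint_kop (sqint_kop sh).
by rewrite (ipZr c sAAh sf) (ipZr c sh sf) ef// mulrCA.
Qed.

Lemma eigenspD f g : eigensp f -> eigensp g -> eigensp (fun x => f x + g x).
Proof.
move=> [sf ef] [sg eg]; split; first exact: sqintD.
move=> h sh; have sAAh := sqint_kop (sqint_kop sh).
by rewrite (ipDr sAAh sf sg) (ipDr sh sf sg) ef// eg// mulrDr.
Qed.

Lemma eigensp0 : eigensp (fun=> 0).
Proof. by split; [exact: sqint0|move=> h sh; rewrite !ip0r mulr0]. Qed.

Lemma eigensp_sum n (c : 'I_n -> R[i]) (e : 'I_n -> T -> R[i]) :
  (forall i, eigensp (e i)) -> eigensp (fun x => \sum_(i < n) c i * e i x).
Proof.
move=> ee; elim: (index_enum _) => [|i s IH].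
  by under eq_fun do rewrite big_nil; exact: eigensp0.
by under eq_fun do rewrite big_cons; apply: eigenspD => //; exact: eigenspZ.
Qed.

(** Each [e i] contributes exactly [opnorm2] to the integrated Bessel inequality, because the
    squared norm of [A (e i)] is the inner product of [A (A (e i))] with [e i]. *)
Lemma orthonormal_eigensp_card n (e : 'I_n -> T -> R[i]) :
  (forall i, eigensp (e i)) ->
  (forall i j, ip nu (e i) (e j) = (i == j)%:R) ->
  n%:R * opnorm2 <= nrm nu2 k.
Proof.
move=> ee oe; apply: le_trans (sum_nrm_kop_le _ oe); last by move=> i; case: (ee i).
have E i : nrm nu (A (e i)) = opnorm2.
  have [se eig] := ee i; apply: (complexI (R := R)).
  rewrite -ip_nrm -kop_adjoint//; last exact: sqint_kop.
  by rewrite eig// oe eqxx mulr1.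
by rewrite (eq_bigr _ (fun i _ => E i)) sumr_const card_ord mulr_natl.
Qed.

(** The cardinality bound makes a largest orthonormal family in the eigenspace exist. It spans:
    otherwise the normalized remainder of some [f] would enlarge it. *)
Lemma eigensp_basis : 0 < opnorm2 -> exists n (e : 'I_n -> T -> R[i]),
  [/\ (0 < n)%N, n%:R * opnorm2 <= nrm nu2 k, forall i, eigensp (e i),
      forall i j, ip nu (e i) (e j) = (i == j)%:R &
      forall f, eigensp f ->
        {ae nu, forall x, f x = \sum_(i < n) ip nu (e i) f * e i x}].
Proof.
move=> s0.
pose P n := `[< exists e : 'I_n -> T -> R[i], (forall i, eigensp (e i)) /\
  (forall i j, ip nu (e i) (e j) = (i == j)%:R) >].
have extend n (e : 'I_n -> T -> R[i]) f : (forall i, eigensp (e i)) ->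
    (forall i j, ip nu (e i) (e j) = (i == j)%:R) ->
    eigensp f -> nrm nu f != 0 -> (forall i, ip nu (e i) f = 0) -> P n.+1.
  move=> ee oe ef f0 ef0; apply/asboolP.
  have {}f0 : 0 < nrm nu f by rewrite lt_neqAle eq_sym f0 nrm_ge0.
  pose c : R[i] := ((Num.sqrt (nrm nu f))^-1)%:C%C.
  pose f' x := c * f x.
  have sf := ef.1; have se i := (ee i).1.
  have ef'0 i : ip nu (e i) f' = 0 by rewrite ipZr// ef0 mulr0.
  have sf' : sqint nu f' by exact: sqintZ.
  have ff' : ip nu f' f' = 1.
    rewrite ip_nrm nrmZ// normsqC exprVn sqr_sqrtr ?nrm_ge0//.
    by rewrite mulVf ?gt_eqF.
  exists (fun i => if unlift ord0 i is Some j then e j else f'); split.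
    by move=> i; case: unliftP => [j _|_] //; exact: eigenspZ.
  move=> i j; case: (unliftP ord0 i) => [i'|] ->; case: (unliftP ord0 j) => [j'|] ->.
  - by rewrite (inj_eq lift_inj).
  - by rewrite ef'0 -(inj_eq val_inj).
  - by rewrite (ipC (se j') sf') ef'0 conjc0 -(inj_eq val_inj).
  - by rewrite ff' eqxx.
have [w [sw w0 ew]] := opnorm2_eigenvector s0.
(* The empty family is extended by the normalized eigenvector [w], so the largest family is
   nonempty. *)
have P1 : P 1%N.
  apply: (@extend 0%N (fun _ _ => 0) w) => //; by case.
have Pb n : P n -> (n <= Num.truncn (nrm nu2 k / opnorm2))%N.
  move=> /asboolP[e [ee oe]]; rewrite truncn_ge_nat; last first.
    by rewrite divr_ge0 ?nrm_ge0// ltW.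
  by rewrite ler_pdivlMr//; exact: orthonormal_eigensp_card ee oe.
case: (ex_maxnP (ex_intro _ 1%N P1) Pb) => n Pn maxn.
have n0 : (0 < n)%N by exact: maxn.
move/asboolP : Pn => [e [ee oe]]; exists n, e; split => //.
  exact: orthonormal_eigensp_card ee oe.
move=> f ef; pose p x := \sum_(i < n) ip nu (e i) f * e i x.
have ep : eigensp p by exact: eigensp_sum.
have er : eigensp (fun x => f x + (-1) * p x).
  by apply: eigenspD => //; exact: eigenspZ.
have [r0|r0] := eqVneq (nrm nu (fun x => f x + (-1) * p x)) 0.
  have := nrm_eq0 er.1 r0; apply: filterS => x.
  by rewrite mulN1r => /eqP; rewrite subr_eq0 => /eqP.
have se i := (ee i).1.
suff /maxn : P n.+1 by rewrite ltnn.
apply: (extend n e _ ee oe er r0) => i.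
have sp := ep.1; have sf := ef.1.
rewrite ipDr//; last exact: sqintZ.
rewrite ipZr// ip_sumr// (bigD1 i)//= oe eqxx mulr1 big1 ?addr0 ?mulN1r ?subrr//.
by move=> j ji; rewrite oe eq_sym (negbTE ji) mulr0.
Qed.

(** Testing the eigenvalue equation against [g] gives 0 on the left and [opnorm2] times the inner
    product on the right. *)
Lemma eigensp_ae_orthogonal f g : sqint nu g -> {ae nu, forall x, A g x = 0} ->
  0 < opnorm2 -> eigensp f -> ip nu g f = 0.
Proof.
move=> sg g0 s0 [sf ef]; have := ef _ sg.
have -> : ip nu (A (A g)) f = 0.
  rewrite kop_adjoint//; last exact: sqint_kop.
  rewrite (ipC (sqint_kop sf) (sqint_kop sg)).
  by rewrite (ae_eq_ipr (sqint_kop sf) (sqint_kop sg) (sqint0 nu) g0) ip0r conjc0.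
move=> /esym/eqP; rewrite mulf_eq0 => /orP[/eqP H|/eqP//].
by move: s0; rewrite (complexI H) ltxx.
Qed.

(** * Kernels invariant under a measure-preserving group action *)

Variables (G : topologicalGroupType) (act : G -> T -> T).
Hypothesis act_meas : forall g : G, measurable_fun setT (act g).
Hypothesis act_pres : forall (g : G) B, measurable B -> nu (act g @^-1` B) = nu B.
Hypothesis act1 : forall x, act 1%g x = x.
Hypothesis actM : forall (g h : G) x, act (g * h)%g x = act g (act h x).
Hypothesis k_inv : forall g : G,
  {ae nu2, forall z, k (act g z.1, act g z.2) = k z}.

Local Notation U g f := (fun x => f (act g^-1%g x)).

Lemma actKV (g : G) x : act g^-1%g (act g x) = x.
Proof. by rewrite -actM mulVg act1. Qed.

Lemma sqint_act (g : G) f : sqint nu f -> sqint nu (fun x => f (act g x)).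
Proof. exact: (sqint_preserving (act_meas g) (@act_pres g)). Qed.

Lemma ip_act (g : G) f h : sqint nu f -> sqint nu h ->
  ip nu h (U g f) = ip nu (fun x => h (act g x)) f.
Proof.
move=> sf sh.
have := ip_preserving (act_meas g) (@act_pres g) sh.1 (sqint_act g^-1%g sf).1.
by move=> <-; congr ip; apply/funext => x; rewrite actKV.
Qed.

(** Invariance of [k] holds for almost every pair, hence on almost every row; there the change of
    variables by [act g] gives the identity. *)
Lemma kop_act (g : G) f : sqint nu f ->
  {ae nu, forall x, A (fun x => f (act g x)) x = A f (act g x)}.
Proof.
move=> sf; apply: filterS (ae_section (k_inv g)) => x kx.
have [mk _] := sk.
have mkx z : cmeasurable (fun y => k (z, y)) by exact: cmeasurable_pairl.
rewrite !kopE -(cintegral_preserving (act_meas g) (@act_pres g)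
   (cmeasurableM (mkx (act g x)) sf.1)).
apply: ae_eq_cintegral.
- by apply: cmeasurableM => //; exact: (sqint_act g sf).1.
- apply: cmeasurableM; last exact: (sqint_act g sf).1.
  by apply: (cmeasurable_comp (mkx (act g x))); exact: act_meas.
- by apply: filterS kx => y /= ->.
Qed.

Lemma ae_eq_kop f g x : sqint nu f -> sqint nu g ->
  {ae nu, forall y, f y = g y} -> A f x = A g x.
Proof. by move=> sf sg fg; rewrite !kop_ip; exact: ae_eq_ipr. Qed.

(** The translation is moved to the test function, where it commutes with [A] twice. The inner
    commutation holds only almost everywhere, but [A] sends almost equal functions to equal
    values. *)
Lemma eigensp_act (g : G) f : eigensp f -> eigensp (U g f).
Proof.
move=> [sf ef]; split; first exact: sqint_act.
move=> h sh; have sAh := sqint_kop sh; have sAAh := sqint_kop sAh.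
have sgh := sqint_act g sh; have sAgh := sqint_kop sgh.
rewrite !ip_act// -(ef _ sgh).
apply: (ae_eq_ipl sf (sqint_act g sAAh) (sqint_kop sAgh)).
apply: filterS (kop_act g sAh) => x <-; symmetry.
apply: (ae_eq_kop x sAgh (sqint_act g sAh)).
exact: kop_act.
Qed.

Hypothesis act_cont : forall f h, sqint nu f -> sqint nu h ->
  ccontinuous (fun g : G => ip nu h (U g f)).

Hypothesis act_ergodic : forall f, sqint nu f ->
  (forall g : G, {ae nu, forall x, U g f x = f x}) ->
  exists c, {ae nu, forall x, f x = c}.

Hypothesis k_mean0 : cintegral nu2 k = 0.

(** The image of 1 is invariant, hence constant by ergodicity, and the constant is the mean of
    [k]. *)
Lemma kop_cst : {ae nu, forall x, A (fun=> 1) x = 0}.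
Proof.
have s1 : sqint nu (fun=> 1) by exact: sqint_cst.
have sA1 := sqint_kop s1.
have [|c Ac] := act_ergodic sA1.
  by move=> g; apply: filterS (kop_act g^-1%g s1) => x <-.
suff c0 : c = 0 by rewrite -c0.
rewrite -[LHS](ip1_cst nu) -(ae_eq_ipr s1 sA1 (sqint_cst nu c) Ac) -kop_form//.
by rewrite -k_mean0; congr cintegral; apply/funext => z; rewrite conjc1 mul1r mulr1.
Qed.

Lemma eigensp_degree : 0 < opnorm2 -> exists m (rho : G -> 'M[R[i]]_m)
    (phi : 'cV[R[i]]_m -> T -> R[i]),
  [/\ m%:R * opnorm2 <= nrm nu2 k,
      [/\ representation rho, irreducible rho & nontrivial rho],
      (forall v, sqint nu (phi v)) /\
      (forall a u v, {ae nu, forall x, phi (a *: u + v) x = a * phi u x + phi v x}),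
      forall (g : G) v, {ae nu, forall x, phi (rho g *m v) x = phi v (act g^-1%g x)} &
      forall v, {ae nu, forall x, phi v x = 0} -> v = 0].
Proof.
move=> s0; have [n [e [n0 ns ee oe expand]]] := eigensp_basis s0.
have se i := (ee i).1.
(* The matrix of the translation by [g] in the orthonormal basis [e]; its entries are continuous by
   [act_cont]. *)
pose rho (g : G) : 'M[R[i]]_n := \matrix_(i, j) ip nu (e i) (U g (e j)).
pose psi (v : 'cV[R[i]]_n) x := \sum_(i < n) v i 0 * e i x.
have epsi v : eigensp (psi v) by exact: eigensp_sum.
have Ue (g : G) j : {ae nu, forall x, U g (e j) x = \sum_(i < n) rho g i j * e i x}.
  have := expand _ (eigensp_act g (ee j)); apply: filterS => x ->.
  by apply: eq_bigr => i _; rewrite mxE.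
have Uallg (g : G) : {ae nu, forall x, forall j,
    U g (e j) x = \sum_(i < n) rho g i j * e i x}.
  by apply: ae_forall_ord => j; exact: Ue.
have Upsi (g : G) v : {ae nu, forall x, psi (rho g *m v) x = U g (psi v) x}.
  apply: filterS (Uallg g) => x Ux; rewrite /psi.
  under [RHS]eq_bigr do rewrite Ux mulr_sumr.
  rewrite exchange_big /=; apply: eq_bigr => i _; rewrite mxE mulr_suml.
  by apply: eq_bigr => j _; rewrite mulrCA mulrA.
have psi_inj v : {ae nu, forall x, psi v x = 0} -> v = 0.
  move=> v0; apply/colP => i; rewrite mxE.
  have := ae_eq_ipr (se i) (epsi v).1 (sqint0 nu) v0; rewrite ip0r.
  rewrite ip_sumr// (bigD1 i)//= oe eqxx mulr1 big1 ?addr0// => j ji.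
  by rewrite oe eq_sym (negbTE ji) mulr0.
have psiB u v x : psi (u - v) x = psi u x - psi v x.
  rewrite /psi -sumrB; apply: eq_bigr => i _.
  by rewrite !mxE mulrBl.
have rho_rep : representation rho.
  split.
  - apply/matrixP => i j; rewrite !mxE -oe; congr ip.
    by apply/funext => x; rewrite invg1 act1.
  - move=> g h; apply/matrixP => i j.
    (* Multiplicativity is checked by columns: [psi] sends the difference of the two columns to a
       function vanishing almost everywhere, and [psi] is injective. *)
    have := psi_inj (matrix.col j (rho (g * h)%g) - rho g *m (rho h *m delta_mx j 0)).
    have aeU := ae_preserving (act_meas g^-1%g) (@act_pres g^-1%g).
    have psij x : psi (delta_mx j 0) x = e j x.
      rewrite /psi (bigD1 j)//= mxE !eqxx mul1r big1 ?addr0// => l lj.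
      by rewrite mxE (negbTE lj) mul0r.
    move=> H; suff: matrix.col j (rho (g * h)%g) - rho g *m (rho h *m delta_mx j 0) = 0.
      move=> /eqP; rewrite subr_eq0 mulmxA -colE => /eqP/colP/(_ i).
      by rewrite mxE [in RHS]mxE.
    apply: H; rewrite colE.
    have h1 := Upsi (g * h)%g (delta_mx j 0).
    have h2 := Upsi g (rho h *m delta_mx j 0).
    have h3 := aeU _ (Upsi h (delta_mx j 0)).
    near=> x; rewrite psiB.
    have -> : psi (rho (g * h)%g *m delta_mx j 0) x = psi (delta_mx j 0) (act (g * h)^-1%g x).
      by near: x.
    have -> : psi (rho g *m (rho h *m delta_mx j 0)) x =
        psi (rho h *m delta_mx j 0) (act g^-1%g x) by near: x.
    have -> : psi (rho h *m delta_mx j 0) (act g^-1%g x) =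
        psi (delta_mx j 0) (act h^-1%g (act g^-1%g x)) by near: x.
    by rewrite -actM -invgM subrr.
  - move=> i j; have [c1 c2] := act_cont (se j) (se i).
    by split; [under eq_fun do rewrite mxE|under eq_fun do rewrite mxE].
have [m [B [rho' [mn rep' irr' BE Binj]]]] := irreducible_subrepresentation n0 rho_rep.
exists m, rho', (fun v => psi (B *m v)).
have phi_act (g : G) v : {ae nu, forall x, psi (B *m (rho' g *m v)) x = U g (psi (B *m v)) x}.
  by rewrite mulmxA BE -mulmxA; exact: Upsi.
have phi_inj v : {ae nu, forall x, psi (B *m v) x = 0} -> v = 0.
  by move=> /psi_inj/Binj.
split => //.
- by apply: le_trans ns; rewrite ler_pM2r// ler_nat.
(* If all [rho' g] were the identity, the function of the all-ones vector would be invariant, hence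
   constant. Orthogonality to 1 makes it vanish, against injectivity. *)
- split => //; apply: contrapT => /forallNP triv.
  have {}triv (g : G) : rho' g = 1%:M by exact: contrapT (triv g).
  pose v : 'cV[R[i]]_m := const_mx 1.
  have m0 : (0 < m)%N by case: irr'.
  suff : v = 0.
    by move=> /colP/(_ (Ordinal m0)); rewrite !mxE => /eqP; rewrite oner_eq0.
  apply: phi_inj; have [sv _] := epsi (B *m v).
  have [|c fc] := act_ergodic sv.
    move=> g; have := phi_act g v; rewrite triv mul1mx.
    by apply: filterS => x <-.
  have s1 : sqint nu (fun=> 1) by exact: sqint_cst.
  have := eigensp_ae_orthogonal s1 kop_cst s0 (epsi (B *m v)).
  rewrite (ae_eq_ipr s1 sv (sqint_cst nu c) fc).
  rewrite ip1_cst.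
  by move=> c0; apply: filterS fc => x ->.
- split; first by move=> v; exact: (epsi _).1.
  move=> a u v; apply: aeW => x; rewrite /psi mulr_sumr -big_split /=.
  by apply: eq_bigr => i _; rewrite mulmxDr -scalemxAr !mxE mulrDl mulrA.
Unshelve. all: by end_near.
Qed.

End HermitianKernel.

(** * Haar measure and coset spaces *)

Section HaarMeasure.
Context {R : realType} {G : topologicalGroupType}.
Hypothesis compact_G : compact [set: G].
Variable mu : probability (borel G) R.
Hypothesis mu_inv : left_invariant mu.
Hypothesis mu_reg : outer_regular mu.

Definition lmulg (g : G) (x : borel G) : borel G := (g * (x : G))%g.
Definition invgb (x : borel G) : borel G := ((x : G)^-1)%g.

Lemma cvg_mulg {T : Type} (F : set_system T) {FF : Filter F} (f h : T -> G) (a b : G) :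
  f @ F --> a -> h @ F --> b -> (fun x => f x * h x)%g @ F --> (a * b)%g.
Proof.
move=> fa hb; apply: (@cvg_comp _ _ _ (fun x => (f x, h x))
  (fun z : G * G => z.1 * z.2)%g F (nbhs (a, b))).
  exact: cvg_pair.
exact: (@mulg_continuous G (a, b)).
Qed.

Lemma lmulg_continuous (g : G) : continuous (fun x : G => g * x)%g.
Proof. by move=> x; apply: cvg_mulg; [exact: cvg_cst|exact: cvg_id]. Qed.

Lemma continuous_borel (f : G -> G) : continuous f ->
  measurable_fun [set: borel G] (f : borel G -> borel G).
Proof.
move=> cf; apply: (@measurability _ _ (borel G) (borel G) setT f (@open G)) => //.
move=> _ [U oU <-]; rewrite setTI; apply: sub_sigma_algebra.
by move/continuousP : cf; exact.
Qed.

Lemma measurable_lmulg g : measurable_fun setT (lmulg g).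
Proof. by apply: (@continuous_borel (lmulg g)); exact: lmulg_continuous. Qed.

Lemma measurable_invgb : measurable_fun setT invgb.
Proof. by apply: (@continuous_borel invgb); exact: invg_continuous. Qed.

Lemma open_measurable_borel (U : set G) : open U -> measurable (U : set (borel G)).
Proof. by move=> oU; exact: sub_sigma_algebra. Qed.

Lemma closed_measurable_borel (C : set G) : closed C -> measurable (C : set (borel G)).
Proof.
move=> clC; rewrite -[C]setCK; apply: measurableC.
by apply: open_measurable_borel; exact: closed_openC.
Qed.

Lemma lmulg_preserving g (A : set (borel G)) : measurable A ->
  mu (lmulg g @^-1` A) = mu A.
Proof.
move=> mA; rewrite -(mu_inv g^-1%g mA); congr (mu _).
apply/seteqP; split => x /=.
  by move=> gxA; exists (g * (x : G))%g => //; rewrite mulKg.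
by move=> [y Ay <-]; rewrite /lmulg mulVKg.
Qed.

(** * Approximation by open and closed sets, and ergodicity of left translations *)

Lemma outer_open (A : set (borel G)) (e : R) : measurable A -> 0 < e ->
  exists U : set (borel G), [/\ open (U : set G), A `<=` U & (mu U <= mu A + e%:E)%E].
Proof.
move=> mA e0.
have Afin : ereal_inf [set mu U | U in [set U : set G | open U /\ A `<=` U]]
    \is a fin_num by rewrite -mu_reg// fin_num_measure.
have [_ [U [oU AU] <-]] := lb_ereal_inf_adherent e0 Afin.
by rewrite -mu_reg// => /ltW; exists U.
Qed.

(** Outer approximation of the complement, turned around by the total mass 1. *)
Lemma inner_closed (A : set (borel G)) (e : R) : measurable A -> 0 < e ->
  exists C : set (borel G), [/\ closed (C : set G), C `<=` A & (mu A <= mu C + e%:E)%E].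
Proof.
move=> mA e0; have [U [oU AU Ue]] := outer_open (measurableC mA) e0.
have mU := open_measurable_borel oU.
exists (~` U); split; first exact: open_closedC.
  by rewrite -[A]setCK; exact: subsetC.
have EU : mu (~` U) = (1 - mu U)%E by exact: probability_setC.
have EA : mu (~` A) = (1 - mu A)%E by exact: probability_setC.
move: Ue; rewrite EU EA.
have : mu U \is a fin_num by exact: fin_num_measure.
have : mu A \is a fin_num by exact: fin_num_measure.
move=> /fineK <- /fineK <-; rewrite -!EFinB -!EFinD !lee_fin.
by move=> h; lra.
Qed.

Lemma tube (C U : set G) : closed C -> open U -> C `<=` U ->
  \forall w \near (1%g : G), forall c, C c -> U (w * c)%g.
Proof.
move=> clC oU CU.
have cC : compact C by exact: subclosed_compact clC compact_G (fun _ _ => I).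
have := (compact_near_coveringP C).1 cC G (nbhs (1%g : G)) (fun w c => U (w * c)%g) _.
apply => c Cc.
have : nbhs ((1%g : G) * c)%g U by rewrite mul1g; apply: open_nbhs_nbhs; split => //; exact: CU.
move=> /(@mulg_continuous G ((1%g : G), c)) [[P Q] /= [P1 Qc] PQ].
by exists (Q, P) => //= -[a b] [/= Qa Pb]; exact: (PQ (b, a)).
Qed.

(** The expression is continuous with value [c] at [w1 = w2 = 1], and compactness of [C] makes the
    neighbourhood uniform. Products [w1^-1 w2 c] arise as quotients of a point of [y W] and a point
    of [y W C]. *)
Lemma tube2 (C U : set G) : closed C -> open U -> C `<=` U ->
  exists W : set G, [/\ open W, W 1%g &
    forall w1 w2 c, W w1 -> W w2 -> C c -> U (w1^-1 * (w2 * c))%g].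
Proof.
move=> clC oU CU.
have cC : compact C by exact: subclosed_compact clC compact_G (fun _ _ => I).
pose F := filter_prod (nbhs (1%g : G)) (nbhs (1%g : G)).
have := (compact_near_coveringP C).1 cC (G * G)%type F
  (fun w c => U (w.1^-1 * (w.2 * c))%g) _.
have H : forall c, C c -> \near c & F, U (F.1^-1 * (F.2 * c))%g.
  move=> c Cc.
  pose h (z : G * (G * G)) := (z.2.1^-1 * (z.2.2 * z.1))%g.
  have ch : h @ (c, (1%g : G, 1%g : G)) --> h (c, (1%g : G, 1%g : G)).
    apply: cvg_mulg.
      apply: (@continuous_comp _ _ _ (fun z : G * (G * G) => z.2.1) (fun x : G => x^-1%g)).
        by apply: (@continuous_comp _ _ _ snd fst); [exact: cvg_snd|exact: cvg_fst].
      exact: invg_continuous.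
    apply: cvg_mulg; last exact: cvg_fst.
    by apply: (@continuous_comp _ _ _ snd snd); [exact: cvg_snd|exact: cvg_snd].
  have : nbhs (h (c, (1%g : G, 1%g : G))) U.
    by rewrite /h /= invg1 !mul1g; apply: open_nbhs_nbhs; split => //; exact: CU.
  by move/ch.
have FF : Filter F by exact: filter_prod_filter.
move=> /(_ FF H) [[P Q] /= [P1 Q1] PQ].
exists ((P `&` Q)^°); split; first exact: open_interior.
  by apply: filterI.
move=> w1 w2 c /interior_subset[Pw1 _] /interior_subset[_ Qw2].
exact: (PQ (w1, w2)).
Qed.

(* Covering [G] by translates of a small neighbourhood replaces Fubini's theorem on
   [G * G], where the map (x, y) |-> y^-1 x need not be measurable for the product
   sigma-algebra. *)
Lemma invariant_set_mul_le (A : set (borel G)) (C U : set G) : measurable A ->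
  (forall g X, measurable X -> mu (A `&` (lmulg g @^-1` X)) = mu (A `&` X)) ->
  closed C -> open U -> C `<=` U ->
  (mu A * mu C <= mu (A `&` (invgb @^-1` U)))%E.
Proof.
move=> mA invA clC oU CU; have [W [oW W1 HW]] := tube2 clC oU CU.
(* This is the product set [W C], an open set around [C]. *)
pose U' : set G := \bigcup_(c in C) [set x | W (x * c^-1)%g].
have oU' : open U'.
  apply: bigcup_open => c _.
  apply: (@open_comp _ _ (fun x : G => x * c^-1)%g) => // x _.
  by apply: cvg_mulg; [exact: cvg_id|exact: cvg_cst].
have mU' := open_measurable_borel oU'.
have mU := open_measurable_borel oU; have mC := closed_measurable_borel clC.
have CU' : C `<=` U' by move=> c Cc; exists c => //=; rewrite mulgV.
pose f (y : G) : set G := [set z | W (y^-1 * z)%g].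
have of_ y : open (f y).
  by apply: (@open_comp _ _ (fun x : G => y^-1 * x)%g) => // x _; exact: lmulg_continuous.
have [D' _ D'G] : finite_subset_cover [set: G] f [set: G].
  move: compact_G; rewrite compact_cover; apply => // z _.
  by exists z => //; rewrite /f /= mulVg.
pose s : seq G := finmap.enum_fset D'.
pose y n := nth (1%g : G) s n.
pose B := seqDU (fun n => f (y n) : set (borel G)).
have mB n : measurable (B n).
  by apply: seqDU_measurable => i; exact: open_measurable_borel.
have BT : \big[setU/set0]_(i < size s) B i = [set: borel G].
  apply/seteqP; split => // z _; rewrite /B -bigsetU_seqDU.
  have /= <- := bigcup_mkord (size s) (fun n => f (y n) : set (borel G)).
  have [i iD fz] := D'G z I.
  have is_ : i \in s by [].
  exists (index i s); first by rewrite /= index_mem.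
  by rewrite /y nth_index.
pose E n := lmulg (y n)^-1%g @^-1` (U' : set (borel G)).
have mE n : measurable (E n).
  by rewrite -[E n]setTI; apply: measurable_lmulg.
have muE n : mu (E n) = mu U' by exact: lmulg_preserving.
(* The sum over [n] discretizes the measure of the [z] in [A] with [z^-1 x] in [C]: on the piece
   [B n] of [y n W], the point [z] is replaced by [y n], and [C] is enlarged to [W C]. *)
pose phi n x := (mu (A `&` B n) * (\1_(E n) x)%:E)%E.
have mAB n : measurable (A `&` B n) by exact: measurableI.
have phi_le x : (\sum_(i < size s) phi i x <= mu (A `&` (invgb @^-1` U)))%E.
  have mVU : measurable (invgb @^-1` (U : set (borel G))).
    by rewrite -[X in measurable X]setTI; exact: measurable_invgb.
  have mxU : measurable (lmulg x^-1%g @^-1` (invgb @^-1` (U : set (borel G)))).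
    by rewrite -[X in measurable X]setTI; exact: measurable_lmulg.
  (* By invariance of [A] the right side is the measure of the [z] in [A] with [z^-1 x] in [U], so
     it suffices to include the disjoint sets [Z n] there. *)
  rewrite -(invA (x^-1)%g _ mVU).
  pose Z n := if pselect (E n x) then A `&` B n else set0.
  have mZ n : measurable (Z n) by rewrite /Z; case: pselect => /= _; [exact: mAB|exact: measurable0].
  have tZ : trivIset setT Z.
    apply: (@sub_trivIset _ _ _ setT) => //.
    have := trivIset_seqDU (fun n => f (y n) : set (borel G)).
    rewrite -/B => tB i j _ _ [z [Zi Zj]]; apply: tB => //; exists z.
    by move: Zi Zj; rewrite /Z; do 2 case: pselect => //; move=> _ _ [_ ?] [_ ?].
  have -> : (\sum_(i < size s) phi i x = \sum_(i < size s) mu (Z i))%E.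
    apply: eq_bigr => i _; rewrite /phi /Z indicE.
    case: pselect => Ex; first by rewrite mem_set// mule1.
    by rewrite memNset// mule0 measure0.
  rewrite -measure_bigsetU//; apply: le_measure; rewrite ?inE.
  - exact: bigsetU_measurable.
  - exact: measurableI.
  - rewrite -bigcup_mkord => z [i _]; rewrite /Z; case: pselect => // -[c Cc /= w2] [Az Bz].
    split => //=; rewrite /invgb /lmulg invgM invgK.
    have := subset_seqDU Bz; rewrite /f /= => w1.
    have := HW _ _ _ w1 w2 Cc.
    by rewrite invgM invgK /lmulg mulgVK -!mulgA mulVKg.
(* Integration over [x] turns each indicator into [mu U'] by left invariance, and the pieces of [A]
   add up to [mu A]. *)
have : (\int[mu]_x (\sum_(i < size s) phi i x) <= \int[mu]_x mu (A `&` (invgb @^-1` U)))%E.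
  apply: ge0_le_integral => //.
  - by move=> x _; apply: sume_ge0 => i _; rewrite mule_ge0// lee_fin.
  - apply: emeasurable_sum => i; apply: emeasurable_funM => //.
    by apply/measurable_EFinP; exact: measurable_indic.
rewrite integral_cst// [X in (_ <= _ * X)%E]probability_setT mule1; apply: le_trans.
rewrite ge0_integral_sum//; last 2 first.
- move=> i; apply: emeasurable_funM => //.
  by apply/measurable_EFinP; exact: measurable_indic.
- by move=> i x _; rewrite mule_ge0// lee_fin.
rewrite (eq_bigr (fun i : 'I_(size s) => mu (A `&` B i) * mu U')%E); last first.
  move=> i _; rewrite ge0_integralZl//.
  - by congr (_ * _)%E; rewrite integral_indic// setIT; exact: muE.
  - by apply/measurable_EFinP; exact: measurable_indic.
rewrite -ge0_sume_distrl//.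
have -> : (\sum_(i < size s) mu (A `&` B i) = mu A)%E.
  rewrite -(measure_bigsetU mu (F := fun i => A `&` B i))//.
    by rewrite -big_distrr /= BT setIT.
  by apply: trivIset_setIl; exact: trivIset_seqDU.
by apply: lee_wpmul2l => //; apply: le_measure; rewrite ?inE.
Qed.

(** Regularity supplies a closed [C] inside [B] and an open [Q] around the inverses of [B], each at
    the cost of [e / 2]; the inverse of [Q] serves as [U]. *)
Lemma invariant_set_mul_inv_le (A B : set (borel G)) : measurable A -> measurable B ->
  (forall g X, measurable X -> mu (A `&` (lmulg g @^-1` X)) = mu (A `&` X)) ->
  (mu A * mu B <= mu (A `&` (invgb @^-1` B)))%E.
Proof.
move=> mA mB invA.
have mV (X : set (borel G)) : measurable X -> measurable (invgb @^-1` X).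
  by move=> mX; rewrite -[X in measurable X]setTI; exact: measurable_invgb.
apply/lee_addgt0Pr => e e0; have e2 : 0 < e / 2 by rewrite divr_gt0.
have [C [clC CB Ce]] := inner_closed mB e2.
have [Q [oQ BQ Qe]] := outer_open (mV _ mB) e2.
have oU : open ((fun x : G => x^-1%g) @^-1` Q).
  by apply: open_comp => // x _; exact: invg_continuous.
have mQ := open_measurable_borel oQ; have mC := closed_measurable_borel clC.
have := invariant_set_mul_le mA invA clC oU.
have -> : invgb @^-1` ((fun x : G => x^-1%g) @^-1` Q) = Q.
  by apply/seteqP; split => x /=; rewrite /invgb invgK.
have CU : C `<=` (fun x : G => x^-1%g) @^-1` Q.
  by move=> c /CB Bc; apply: BQ; rewrite /= /invgb invgK.
move=> /(_ CU) H.
have A1 : (mu A <= 1)%E by exact: probability_le1.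
have mQB : measurable (Q `\` (invgb @^-1` B)) by apply: measurableD => //; exact: mV.
have H2 : (mu (A `&` Q) <= mu (A `&` (invgb @^-1` B)) + (e / 2)%:E)%E.
  have : (mu (A `&` Q) <= mu (A `&` (invgb @^-1` B)) + mu (Q `\` (invgb @^-1` B)))%E.
    apply: le_trans (measureU2 _ _ _); rewrite ?inE//; last first.
      by apply: measurableI => //; exact: mV.
    apply: le_measure; rewrite ?inE//; first exact: measurableI.
      by apply: measurableU => //; apply: measurableI => //; exact: mV.
    move=> x [Ax Ox]; have [|] := pselect (B (invgb x)); [by left|by right].
  move=> /le_trans; apply; rewrite leeD2l//.
  have := Qe; rewrite (_ : Q = (invgb @^-1` B) `|` (Q `\` (invgb @^-1` B))); last first.
    by rewrite setDUK.
  rewrite measureU//; [|exact: mV|by rewrite setDIK].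
  have : mu (invgb @^-1` B) \is a fin_num by apply: fin_num_measure; exact: mV.
  by move=> ?; rewrite leeD2lE// setDUK.
have H1 : (mu A * mu B <= mu A * mu C + (e / 2)%:E)%E.
  apply: le_trans (lee_wpmul2l (measure_ge0 _ _) Ce) _.
  rewrite muleDr ?fin_num_measure//; last exact: fin_num_adde_defl.
  by rewrite leeD2l// -[leRHS]mul1e lee_wpmul2r// lee_fin ltW.
apply: le_trans H1 _; apply: le_trans (leeD2r _ H) _.
apply: le_trans (leeD2r _ H2) _.
by rewrite -addeA -EFinD -splitr.
Qed.

(** Let [B] consist of the inverses of the complement of [A]. The product inequality gives
    [mu A * mu B <= 0]. For the whole group in place of [A] it shows that inversion does not lower
    the measure, so [mu B] is at least that of the complement. *)
Lemma invariant_set_trivial (A : set (borel G)) : measurable A ->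
  (forall g, mu (A `\` lmulg g @^-1` A) = 0%E) -> mu A = 0%E \/ mu (~` A) = 0%E.
Proof.
move=> mA invA.
have ml g (X : set (borel G)) : measurable X -> measurable (lmulg g @^-1` X).
  by move=> mX; rewrite -[X in measurable X]setTI; exact: measurable_lmulg.
(* Up to the null part of [A] that [g] moves out of [A], the left set lies in the preimage of the
   intersection of [A] and [X]. The reverse inequality is the same for [g^-1]. *)
have invA' g X : measurable X -> mu (A `&` (lmulg g @^-1` X)) = mu (A `&` X).
  have H h Y : measurable Y -> (mu (A `&` (lmulg h @^-1` Y)) <= mu (A `&` Y))%E.
    move=> mY.
    rewrite -[in leRHS](lmulg_preserving h); last exact: measurableI.
    have mAD : measurable (A `\` lmulg h @^-1` A) by apply: measurableD => //; exact: ml.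
    have m2 : measurable (lmulg h @^-1` (A `&` Y)) by apply: ml; exact: measurableI.
    rewrite -[leRHS]adde0 -(invA h).
    apply: le_trans (measureU2 _ _ _) => //.
    apply: le_measure; rewrite ?inE; [apply: measurableI => //; exact: ml|exact: measurableU|].
    move=> x [Ax Yx]; have [|] := pselect (A (lmulg h x)); [by left|by right].
  move=> mX; apply/eqP; rewrite eq_le H//=.
  have := H g^-1%g _ (ml g _ mX).
  rewrite (_ : lmulg g^-1%g @^-1` (lmulg g @^-1` X) = X)//.
  by apply/seteqP; split => x /=; rewrite /lmulg mulVKg.
have mV (X : set (borel G)) : measurable X -> measurable (invgb @^-1` X).
  by move=> mX; rewrite -[X in measurable X]setTI; exact: measurable_invgb.
have VV (X : set (borel G)) : invgb @^-1` (invgb @^-1` X) = X.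
  by apply/seteqP; split => x /=; rewrite /invgb invgK.
have muV (B : set (borel G)) : measurable B -> (mu B <= mu (invgb @^-1` B))%E.
  move=> mB; have := @invariant_set_mul_inv_le setT B measurableT mB.
  rewrite setTI [X in (X * _)%E]probability_setT mul1e; apply => g X mX.
  by rewrite !setTI lmulg_preserving.
have mAc := mV _ (measurableC mA).
have := invariant_set_mul_inv_le mA mAc invA'.
rewrite VV setICr measure0 => H.
have := le_trans (lee_wpmul2l (measure_ge0 _ _) (muV _ (measurableC mA))) H.
move=> {}H; have /eqP : (mu A * mu (~` A) = 0)%E.
  by apply/eqP; rewrite eq_le H mule_ge0.
by rewrite mule_eq0 => /orP[] /eqP; [left|right].
Qed.

(* Ergodicity: an almost invariant function is constant, because its superlevel
   sets are almost invariant. *)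
Lemma invariant_fun_cst (f : borel G -> R) : mu.-integrable setT (EFin \o f) ->
  (forall g, {ae mu, forall x, f (lmulg g x) = f x}) ->
  {ae mu, forall x, f x = (\int[mu]_y f y)%R}.
Proof.
move=> fi finv; set c := (\int[mu]_y f y)%R.
have mf : measurable_fun setT f by apply/measurable_EFinP; exact: measurable_int fi.
have mlt : measurable [set x | f x < c].
  have := measurable_fun_ltr mf (measurable_cst c).
  by move=> /(_ measurableT [set true] I); rewrite setTI.
have mgt : measurable [set x | c < f x].
  have := measurable_fun_ltr (measurable_cst c) mf.
  by move=> /(_ measurableT [set true] I); rewrite setTI.
have ic : mu.-integrable setT (EFin \o (fun=> c)) by exact: finite_measure_integrable_cst.
have mufine := congr1 fine (probability_setT mu).
have Ic : (\int[mu]_y c = c)%R by rewrite Rintegral_cst// (_ : fine _ = 1) ?mulr1.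
have inv0 (P : R -> Prop) : measurable [set x | P (f x)] ->
    forall g, mu ([set x | P (f x)] `\` lmulg g @^-1` [set x | P (f x)]) = 0%E.
  move=> mP g; have [N [mN N0 fN]] := finv g.
  apply: (subset_measure0 _ mN _ N0).
    by apply: measurableD => //; rewrite -[X in measurable X]setTI; exact: measurable_lmulg.
  by move=> x [/= Px nPx]; apply: fN => /= fx; apply: nPx; rewrite fx.
(* If [f < c] almost everywhere, then [|c - f|] integrates to [c - c = 0], so [f = c] almost
   everywhere and the claim holds in this case too. *)
have ae_lt : {ae mu, forall x, ~ f x < c}.
  have [lt0|ge0] := invariant_set_trivial mlt (@inv0 (fun t => t < c) mlt).
    by exists [set x | f x < c]; split => // x /= /contrapT.
  have gt : {ae mu, forall x, f x < c}.
    by exists (~` [set x | f x < c]); split => //; exact: measurableC.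
  have I0 : (\int[mu]_x `|c - f x| = 0)%R.
    rewrite (ae_eq_Rintegral (g := fun x => c - f x)).
    - by rewrite RintegralB// Ic subrr.
    - apply: measurableT_comp => //.
      by apply: measurable_funB => //; exact: measurable_cst.
    - by apply: measurable_funB => //; exact: measurable_cst.
    - by apply: filterS gt => x fx; rewrite ger0_norm// subr_ge0 ltW.
  have := Rintegral_eq0_ae (integrable_norm (rintegrableB ic fi)) _ I0.
  move=> /(_ (fun x => normr_ge0 _)); apply: filterS => x /eqP.
  by rewrite normr_eq0 subr_eq0 => /eqP ->; rewrite ltxx.
have ae_gt : {ae mu, forall x, ~ c < f x}.
  have [lt0|ge0] := invariant_set_trivial mgt (@inv0 (fun t => c < t) mgt).
    by exists [set x | c < f x]; split => // x /= /contrapT.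
  have gt : {ae mu, forall x, c < f x}.
    by exists (~` [set x | c < f x]); split => //; exact: measurableC.
  have I0 : (\int[mu]_x `|f x - c| = 0)%R.
    rewrite (ae_eq_Rintegral (g := fun x => f x - c)).
    - by rewrite RintegralB// Ic subrr.
    - apply: measurableT_comp => //.
      by apply: measurable_funB => //; exact: measurable_cst.
    - by apply: measurable_funB => //; exact: measurable_cst.
    - by apply: filterS gt => x fx; rewrite ger0_norm// subr_ge0 ltW.
  have := Rintegral_eq0_ae (integrable_norm (rintegrableB fi ic)) _ I0.
  move=> /(_ (fun x => normr_ge0 _)); apply: filterS => x /eqP.
  by rewrite normr_eq0 subr_eq0 => /eqP ->; rewrite ltxx.
apply: filterS2 ae_lt ae_gt => x /negP; rewrite -leNgt => h1 /negP; rewrite -leNgt => h2.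
by apply/eqP; rewrite eq_le h1 h2.
Qed.

(** * Continuity of left translations in L_1 *)

Definition translation_dist (h : borel G -> R) (w : G) : R :=
  (\int[mu]_x `|h (lmulg w^-1%g x) - h x|)%R.

Lemma integrable_lmulg (h : borel G -> R) w : mu.-integrable setT (EFin \o h) ->
  mu.-integrable setT (EFin \o (fun x => h (lmulg w x))).
Proof. exact: (integrable_preserving (measurable_lmulg w) (@lmulg_preserving w)). Qed.

Lemma integrable_translation_dist (h : borel G -> R) w :
  mu.-integrable setT (EFin \o h) ->
  mu.-integrable setT (EFin \o (fun x => `|h (lmulg w x) - h x|)).
Proof.
by move=> ih; exact: (integrable_norm (rintegrableB (integrable_lmulg w ih) ih)).
Qed.

Definition translation_continuous (h : borel G -> R) :=
  mu.-integrable setT (EFin \o h) /\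
  forall e, 0 < e -> \forall w \near (1%g : G), translation_dist h w <= e.

Lemma translation_continuousD h1 h2 : translation_continuous h1 ->
  translation_continuous h2 -> translation_continuous (fun x => h1 x + h2 x).
Proof.
move=> [i1 c1] [i2 c2]; split; first exact: rintegrableD.
move=> e e0; have e2 : 0 < e / 2 by rewrite divr_gt0.
apply: filterS2 (c1 _ e2) (c2 _ e2) => w h1w h2w.
rewrite [leRHS]splitr; apply: le_trans (lerD h1w h2w).
have j1 := integrable_translation_dist w^-1%g i1.
have j2 := integrable_translation_dist w^-1%g i2.
rewrite /translation_dist -RintegralD//; apply: le_Rintegral => //.
- by apply: integrable_translation_dist; exact: rintegrableD.
- exact: rintegrableD.
- by move=> x _; rewrite opprD addrACA ler_normD.
Qed.

Lemma translation_continuousZ c h : translation_continuous h ->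
  translation_continuous (fun x => c * h x).
Proof.
move=> [i1 c1]; split; first exact: rintegrableZ.
(* The added 1 keeps the denominator positive when [c = 0]. *)
move=> e e0; have c0 : 0 < `|c| + 1 by rewrite ltr_wpDl.
have e2 : 0 < e / (`|c| + 1) by rewrite divr_gt0.
apply: filterS (c1 _ e2) => w hw.
have j1 := integrable_translation_dist w^-1%g i1.
have -> : translation_dist (fun x => c * h x) w = `|c| * translation_dist h w.
  rewrite /translation_dist -RintegralZl//; apply: eq_Rintegral => x _.
  by rewrite -mulrBr normrM.
apply: (@le_trans _ _ ((`|c| + 1) * translation_dist h w)).
  by rewrite ler_wpM2r ?lerDl// Rintegral_ge0.
by rewrite mulrC -ler_pdivlMr.
Qed.

(** Translation preserves the L_1 distance of [h] and [g], so three terms of size [e / 3]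
    suffice. *)
Lemma translation_continuous_lim h : mu.-integrable setT (EFin \o h) ->
  (forall e, 0 < e -> exists g, translation_continuous g /\
     (\int[mu]_x `|h x - g x|)%R <= e) -> translation_continuous h.
Proof.
move=> ih happ; split => // e e0; have e3 : 0 < e / 3 by rewrite divr_gt0.
have [g [[ig cg] hg]] := happ _ e3.
apply: filterS (cg _ e3) => w gw.
have id : mu.-integrable setT (EFin \o (fun x => `|h x - g x|)).
  exact: (integrable_norm (rintegrableB ih ig)).
have idw := integrable_lmulg w^-1%g id.
have ig' := integrable_translation_dist w^-1%g ig.
have E : (\int[mu]_x `|h (lmulg w^-1%g x) - g (lmulg w^-1%g x)| =
          \int[mu]_x `|h x - g x|)%R.
  apply: (Rintegral_preserving (measurable_lmulg _) (@lmulg_preserving _)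
           (f := fun x => `|h x - g x|)).
  by apply/measurable_EFinP; exact: measurable_int id.
have -> : e = e / 3 + e / 3 + e / 3 by lra.
apply: (@le_trans _ _ (\int[mu]_x (`|h (lmulg w^-1%g x) - g (lmulg w^-1%g x)| +
   `|g (lmulg w^-1%g x) - g x| + `|h x - g x|))%R).
  apply: le_Rintegral => //.
  - exact: integrable_translation_dist.
  - by apply: rintegrableD => //; exact: rintegrableD.
  - move=> x _; move: (h _) (h _) (g _) (g _) => a b c d.
    rewrite (distrC a c); apply: le_trans (ler_distD c b a) _.
    by rewrite lerD2r ler_distD.
rewrite RintegralD//; last exact: rintegrableD.
by rewrite RintegralD// E lerD// lerD.
Qed.

(** Squeeze [A] between a closed [C] and an open [U] that contains [w C] for [w] near 1. The bound
    on the difference integrates to [2 (mu U - mu C)], which is at most [e] when each approximation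
    costs [e / 4]. *)
Lemma translation_continuous_indic (A : set (borel G)) : measurable A ->
  translation_continuous \1_A.
Proof.
move=> mA; have iI (X : set (borel G)) : measurable X ->
  mu.-integrable setT (EFin \o \1_X) by exact: integrable_indic.
split; first exact: iI.
move=> e e0; have e4 : 0 < e / 4 by rewrite divr_gt0.
have [C [clC CA Ce]] := inner_closed mA e4.
have [U [oU AU Ue]] := outer_open mA e4.
have mU := open_measurable_borel oU; have mC := closed_measurable_borel clC.
have RI X : measurable X -> (\int[mu]_x \1_X x)%R = fine (mu X).
  by move=> mX; rewrite /Rintegral integral_indic// setIT.
have CU : C `<=` U by exact: subset_trans CA AU.
apply: filterS (tube clC oU CU) => w wC.
pose f X x : R := \1_X (lmulg w^-1%g x).
have fi X : measurable X -> mu.-integrable setT (EFin \o f X).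
  by move=> mX; apply: (integrable_lmulg (h := \1_X)); exact: iI.
have fI X : measurable X -> (\int[mu]_x f X x)%R = fine (mu X).
  move=> mX; rewrite -RI//.
  apply: (Rintegral_preserving (measurable_lmulg _) (@lmulg_preserving _)
           (f := \1_X)).
  exact: measurable_indic.
apply: (@le_trans _ _ (\int[mu]_x ((f A x - f C x) + (\1_U x - f C x) +
    (\1_U x - \1_A x)))%R).
  apply: le_Rintegral => //.
  - by apply: (integrable_translation_dist (h := \1_A)); exact: iI.
  - apply: rintegrableD; last by apply: rintegrableB; exact: iI.
    by apply: rintegrableD; apply: rintegrableB; try exact: fi; exact: iI.
  - move=> x _; rewrite -[X in `|X - _|]/(f A x).
    have h1 : f C x <= f A x.
      by rewrite /f !indicE ler_nat; case: (boolP (_ \in C)) => // /set_mem/CA/mem_set ->.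
    have h2 : f C x <= \1_U x.
      rewrite /f !indicE ler_nat; case: (boolP (_ \in C)) => // /set_mem/wC.
      by rewrite /lmulg mulVKg => /mem_set ->.
    have h3 : \1_A x <= \1_U x :> R.
      by rewrite !indicE ler_nat; case: (boolP (_ \in A)) => // /set_mem/AU/mem_set ->.
    by rewrite ler_norml; apply/andP; split; lra.
rewrite RintegralD//; last 2 first.
- by apply: rintegrableD; apply: rintegrableB; try exact: fi; exact: iI.
- by apply: rintegrableB; exact: iI.
rewrite RintegralD//; last 2 first.
- by apply: rintegrableB; exact: fi.
- by apply: rintegrableB; [exact: iI|exact: fi].
rewrite !RintegralB//; try exact: fi; try exact: iI.
rewrite (fI A)// (fI C)// (RI U)// (RI A)//.
have : mu U \is a fin_num by exact: fin_num_measure.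
have : mu A \is a fin_num by exact: fin_num_measure.
have : mu C \is a fin_num by exact: fin_num_measure.
move: Ce Ue => + + /fineK Cf /fineK Af /fineK Uf.
rewrite -Cf -Af -Uf -!EFinD !lee_fin => h1 h2; lra.
Qed.


Import HBSimple.

Lemma integrable_translation_continuous h : mu.-integrable setT (EFin \o h) ->
  translation_continuous h.
Proof.
move=> ih; apply: translation_continuous_lim => // e e0.
have [g_ [ig _ cg]] := approximation_sfun_integrable measurableT ih.
have /fine_cvgP[_ /cvgrPdist_le/(_ e e0)[N _ /(_ N (leqnn N))]] := cg.
rewrite /= sub0r normrN => hN; exists (g_ N); split; last first.
  by apply: le_trans hN; exact: ler_norm.
have -> : (g_ N : borel G -> R) =
    (fun x => \sum_(y <- finmap.enum_fset (fset_set (range (g_ N))))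
        y * \1_(g_ N @^-1` [set y]) x).
    by apply/funext => x; rewrite fimfunE fsbig_finite.
  elim: (finmap.enum_fset _) => [|y s IH].
    under eq_fun do rewrite big_nil.
    split; first exact: (integrable0 _ setT).
    move=> e' e'0; apply: nearW => w; rewrite /translation_dist.
    under eq_Rintegral do rewrite subrr normr0.
    by rewrite /Rintegral integral0 ltW.
  under eq_fun do rewrite big_cons.
  apply: translation_continuousD => //.
  apply: translation_continuousZ; exact: translation_continuous_indic.
Qed.

(** * The translation action on the coset space *)

Section CosetAction.
Variable K : groupClosed G.
Local Notation V := (borel (left_cosets K)).
Local Notation nu := (coset_measure K mu).

Lemma coset_proj_act (g : G) (x : borel G) :
  @coset_act G K g (@coset_proj G K x) = @coset_proj G K (lmulg g x).
Proof. exact: coset_act_pi. Qed.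

Lemma coset_proj_surj (v : V) : exists x : borel G, v = @coset_proj G K x.
Proof. by exists (repr (v : left_cosets K)); rewrite /coset_proj reprK. Qed.

Lemma coset_act1 (v : V) : @coset_act G K 1%g v = v.
Proof.
have [x ->] := coset_proj_surj v; rewrite coset_proj_act.
by rewrite /lmulg mul1g.
Qed.

Lemma coset_actM (g h : G) (v : V) :
  @coset_act G K (g * h)%g v = @coset_act G K g (@coset_act G K h v).
Proof.
have [x ->] := coset_proj_surj v; rewrite !coset_proj_act.
by rewrite /lmulg mulgA.
Qed.

Lemma measurable_coset_act (g : G) :
  measurable_fun setT (@coset_act G K g : V -> V).
Proof.
apply: (@measurability _ _ V V setT (@coset_act G K g)
          (@open (left_cosets K))) => //.
move=> _ [U oU <-]; rewrite setTI; apply: sub_sigma_algebra.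
rewrite /open /= /quotient_open.
have -> : \pi_(left_cosets K)%qT @^-1` (@coset_act G K g @^-1` U) =
    (fun x : G => g * x)%g @^-1` (\pi_(left_cosets K)%qT @^-1` U).
  by apply/seteqP; split => x /=; rewrite coset_act_pi.
by apply: open_comp => // x _; exact: lmulg_continuous.
Qed.

Lemma coset_act_preserving (g : G) (B : set V) : measurable B ->
  nu (@coset_act G K g @^-1` B) = nu B.
Proof.
move=> mB; rewrite /coset_measure /distribution /pushforward.
have mPB : measurable (@coset_proj G K @^-1` B).
  by rewrite -[X in measurable X]setTI; exact: measurable_coset_proj.
rewrite -[RHS](lmulg_preserving g mPB); congr (mu _).
by apply/seteqP; split => x /=; rewrite coset_proj_act.
Qed.

Lemma coset_proj_preserving (B : set V) : measurable B ->
  mu (@coset_proj G K @^-1` B) = nu B.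
Proof. by []. Qed.

Lemma sqint_rintegrable (f : borel G -> R[i]) : sqint mu f ->
  mu.-integrable setT (EFin \o (fun x => complex.Re (f x))) /\
  mu.-integrable setT (EFin \o (fun x => complex.Im (f x))).
Proof.
move=> sf; have := sqint_cintegrable (sqint_cst mu 1) sf.
by under eq_fun do rewrite conjc1 mul1r.
Qed.

(** The function is pulled back to [G], where its real and imaginary parts are constant by
    [invariant_fun_cst]. The result descends by way of the norm, which the projection preserves. *)
Lemma coset_act_ergodic (f : V -> R[i]) : sqint nu f ->
  (forall g : G, {ae nu, forall x, f (@coset_act G K g^-1%g x) = f x}) ->
  exists c, {ae nu, forall x, f x = c}.
Proof.
move=> sf finv.
have mp := @measurable_coset_proj G K.
pose F x := f (@coset_proj G K x).
have sF : sqint mu F by exact: (sqint_preserving mp coset_proj_preserving sf).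
have Finv g : {ae mu, forall x, F (lmulg g x) = F x}.
  have := ae_preserving mp coset_proj_preserving (finv g^-1%g).
  by apply: filterS => x; rewrite invgK coset_proj_act.
have [iRe iIm] := sqint_rintegrable sF.
have hRe := invariant_fun_cst iRe.
have hIm := invariant_fun_cst iIm.
exists (cintegral mu F).
have sB : sqint nu (fun x => f x - cintegral mu F).
  by apply: sqintB => //; exact: sqint_cst.
have : nrm nu (fun x => f x - cintegral mu F) = 0.
  rewrite -(nrm_preserving mp coset_proj_preserving sB.1).
  have s0 := sqint0 mu.
  rewrite (ae_eq_nrm (g := fun=> 0)).
  - apply: (complexI (R := R)); rewrite -ip_nrm.
    by rewrite ip0r.
  - by have [] := sqint_preserving mp coset_proj_preserving sB.
  - exact: s0.1.
  - have h1 : {ae mu, forall x, complex.Re (F x) = (\int[mu]_y complex.Re (F y))%R}.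
      by apply: hRe => g; apply: filterS (Finv g) => x ->.
    have h2 : {ae mu, forall x, complex.Im (F x) = (\int[mu]_y complex.Im (F y))%R}.
      by apply: hIm => g; apply: filterS (Finv g) => x ->.
    apply: filterS2 h1 h2 => x e1 e2.
    by apply/eqP; rewrite subr_eq0; apply/eqP; apply: complexP.
move=> /(nrm_eq0 sB); apply: filterS => x /eqP.
by rewrite subr_eq0 => /eqP.
Qed.

(** This passes from L_1 to L_2: the signed square of a square-integrable function is integrable,
    and its L_1 continuity controls the squared differences. The factor 2 is for arguments of
    opposite sign. *)
Lemma sqr_sub_le_signed (a b : R) : (a - b) ^+ 2 <= 2 * `|a * `|a| - b * `|b| |.
Proof.
wlog ab : a b / b <= a.
  move=> H; have [/H//|/ltW /H] := leP b a.
  by rewrite -[(b - a) ^+ 2]sqrrN opprB distrC.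
have [a0|a0] := leP 0 a; have [b0|b0] := leP 0 b.
- rewrite (ger0_norm a0) (ger0_norm b0) ger0_norm; last by nra.
  nra.
- rewrite (ger0_norm a0) (ltr0_norm b0) ger0_norm; last by nra.
  have := sqr_ge0 (a + b); nra.
- by exfalso; lra.
- rewrite (ltr0_norm a0) (ltr0_norm b0) ger0_norm; last by nra.
  nra.
Qed.

Lemma nrm_translation_small (f : V -> R[i]) e : sqint nu f -> 0 < e ->
  \forall w \near (1%g : G), nrm nu (fun x => f (@coset_act G K w^-1%g x) - f x) <= e.
Proof.
move=> sf e0; have mp := @measurable_coset_proj G K.
pose F x := f (@coset_proj G K x).
have sF : sqint mu F by exact: (sqint_preserving mp coset_proj_preserving sf).
have [[mR mI] iF] := sF.
pose S (t : R) := t * `|t|.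
have ms (h : borel G -> R) : measurable_fun setT h -> measurable_fun setT (fun x => S (h x)).
  by move=> mh; apply: measurable_funM => //; exact: measurableT_comp.
have iR : mu.-integrable setT (EFin \o (fun x => S (complex.Re (F x)))).
  apply: (le_rintegrable (ms _ mR) iF) => x.
  by rewrite /S normrM normr_id -expr2 real_normK ?num_real// lerDl sqr_ge0.
have iI : mu.-integrable setT (EFin \o (fun x => S (complex.Im (F x)))).
  apply: (le_rintegrable (ms _ mI) iF) => x.
  by rewrite /S normrM normr_id -expr2 real_normK ?num_real// lerDr sqr_ge0.
(* Real and imaginary part each contribute [2 * (e / 4)]. *)
have e4 : 0 < e / 4 by rewrite divr_gt0.
have [_ cR] := integrable_translation_continuous iR.
have [_ cI] := integrable_translation_continuous iI.
apply: filterS2 (cR _ e4) (cI _ e4) => w hR hI.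
have sB : sqint nu (fun x => f (@coset_act G K w^-1%g x) - f x).
  apply: sqintB => //.
  exact: (sqint_preserving (measurable_coset_act _) (@coset_act_preserving _) sf).
rewrite -(nrm_preserving mp coset_proj_preserving sB.1).
have [_ iB] := sqint_preserving mp coset_proj_preserving sB.
have jR := integrable_translation_dist w^-1%g iR.
have jI := integrable_translation_dist w^-1%g iI.
apply: (@le_trans _ _ (2 * translation_dist (fun x => S (complex.Re (F x))) w +
   2 * translation_dist (fun x => S (complex.Im (F x))) w)); last by lra.
rewrite /translation_dist -!RintegralZl// -RintegralD//; try exact: rintegrableZ.
apply: le_Rintegral => //; first by apply: rintegrableD; exact: rintegrableZ.
move=> x _; rewrite /normsq !ReImE coset_proj_act -[f (coset_proj K x)]/(F x).
by apply: lerD; exact: sqr_sub_le_signed.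
Qed.

Lemma coset_act_ccontinuous (f h : V -> R[i]) : sqint nu f -> sqint nu h ->
  ccontinuous (fun g : G => ip nu h (fun x => f (@coset_act G K g^-1%g x))).
Proof.
move=> sf sh.
have sU g : sqint nu (fun x => f (@coset_act G K g x)).
  exact: (sqint_preserving (measurable_coset_act _) (@coset_act_preserving _) sf).
pose r (g : G) := ip nu h (fun x => f (@coset_act G K g^-1%g x)).
have H (g0 : G) (e : R) : 0 < e -> \forall g \near g0, normsq (r g0 - r g) <= e ^+ 2.
  move=> e0; have nh : 0 < nrm nu h + 1 by rewrite ltr_wpDl ?nrm_ge0.
  have e1 : 0 < e ^+ 2 / (nrm nu h + 1) by rewrite divr_gt0// exprn_gt0.
  have cg0 : (fun g : G => g0^-1 * g)%g @ g0 --> (1%g : G).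
    by rewrite -(mulVg g0); exact: lmulg_continuous.
  have near_g0 : \forall g \near g0,
      nrm nu (fun x => f (@coset_act G K (g0^-1 * g)^-1%g x) - f x) <=
      e ^+ 2 / (nrm nu h + 1).
    exact: (cg0 _ (nrm_translation_small sf e1)).
  apply: filterS near_g0 => g hg.
  rewrite /r -ipBr//; apply: le_trans (cauchy_schwarz _ _) _ => //.
    exact: sqintB.
  (* Translating by [g0] reduces the difference at [g0] and [g] to the one at the identity and
     [g0^-1 g]. *)
  have <- : nrm nu (fun x => f (@coset_act G K (g0^-1 * g)^-1%g x) - f x) =
    nrm nu (fun x => f (@coset_act G K g0^-1%g x) - f (@coset_act G K g^-1%g x)).
    rewrite -(nrm_preserving (measurable_coset_act g0) (@coset_act_preserving g0)
       (sqintB (sU g0^-1%g) (sU g^-1%g)).1).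
    apply: eq_Rintegral => x _; rewrite -normsqN opprB -!coset_actM mulVg coset_act1.
    by rewrite invgM invgK.
  rewrite ler_pdivlMr// in hg; apply: le_trans hg.
  by rewrite mulrC ler_wpM2l ?nrm_ge0// lerDl.
split => g0; apply/cvgrPdist_le => e e0; apply: filterS (H g0 e e0) => g hg.
  rewrite -(@ler_pXn2r _ 2)// ?nnegrE ?(ltW e0)// real_normK ?num_real//.
  apply: le_trans hg; rewrite -[X in X ^+ 2]/(complex.Re (r g0) - complex.Re (r g)).
  by rewrite /normsq !ReImE lerDl sqr_ge0.
rewrite -(@ler_pXn2r _ 2)// ?nnegrE ?(ltW e0)// real_normK ?num_real//.
apply: le_trans hg; rewrite -[X in X ^+ 2]/(complex.Im (r g0) - complex.Im (r g)).
by rewrite /normsq !ReImE lerDr sqr_ge0.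
Qed.

End CosetAction.
End HaarMeasure.

(** Admissible [f] and [g] lie in the unit ball of L_2, so Cauchy-Schwarz applied to [f] and the
    image of [g] gives the bound. *)
Lemma cut_norm_le_opnorm {d : measure_display} {T : measurableType d} {R : realType}
    (nu : probability T R) (k K : T * T -> R[i]) :
  sqint (nu \x nu)%E k -> (forall x y, k (x, y) = conjc (k (y, x))) ->
  (forall x, sqint nu (fun y => k (y, x))) -> cmeasurable K ->
  {ae (nu \x nu)%E, forall z, k z = K z} ->
  (cut_norm nu K <= (Num.sqrt (opnorm2 nu k))%:E)%E.
Proof.
move=> sk k_herm k_col mK kK; apply: ge_ereal_sup => _ [f [g [mf f1 mg g1 ->]]].
have [sf nf] := sqint_ess_le1 mf f1; have [sg ng] := sqint_ess_le1 mg g1.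
rewrite lee_fin normc_sqrt ler_wsqrtr//.
have <- : cintegral (nu \x nu)%E (fun z => conjc (f z.1) * k z * g z.2) =
    cintegral (nu \x nu)%E (fun z => conjc (f z.1) * K z * g z.2).
  apply: ae_eq_cintegral.
  - exact: (cmeasurable_kernelM sk.1 (cmeasurableJ mf) mg).
  - exact: (cmeasurable_kernelM mK (cmeasurableJ mf) mg).
  - by apply: filterS kK => z ->.
rewrite kop_form//.
have skg := sqint_kop sk k_herm k_col sg.
apply: le_trans (cauchy_schwarz sf skg) _.
apply: (@le_trans _ _ (nrm nu (kop nu k g))).
  by rewrite ler_piMl// nrm_ge0.
exact: opnorm2_ge.
Qed.

Theorem corollary1p3 (R : realType) (G : topologicalGroupType)
    (compact_G : compact [set: G]) (hausdorff_G : hausdorff_space G)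
    (mu : probability (borel G) R) (haar_mu : normalized_haar mu)
    (K : groupClosed G) (closed_K : closed [set x : G | x \in K])
    (d : nat) (smallest_d : smallest_nontrivial_degree mu K d)
    (H : borel (left_cosets K) * borel (left_cosets K) -> R[i]) :
  let nu := coset_measure K mu in
  hilbert_schmidt_kernel nu H ->
  self_adjoint nu H ->
  invariant_kernel mu H ->
  (cLnorm (nu \x nu) 2%:E H <= 1)%E ->
  (cut_norm nu (fun z => (H z - mean nu H)%R) <= (1 / Num.sqrt d%:R)%:E)%E.
Proof.
move=> nu /cL2_sqint sH aH iH H1.
have [mu_inv mu_reg _] := haar_mu.
have act_meas := @measurable_coset_act G K.
have act_pres := coset_act_preserving mu_inv (K := K).
have [sK aK meanK nK] := centered_kernel sH aH.
have [k [sk k_herm k_col kK]] := hermitian_modification sK aK.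
have nk : nrm (nu \x nu)%E k <= 1.
  rewrite (ae_eq_nrm sk.1 sK.1 kK); apply: le_trans nK _.
  exact: nrm_cLnorm_le1 sH H1.
have k_mean0 : cintegral (nu \x nu)%E k = 0.
  by rewrite (ae_eq_cintegral sk.1 sK.1 kK).
have k_inv g : {ae (nu \x nu)%E, forall z,
    k (@coset_act G K g z.1, @coset_act G K g z.2) = k z}.
  have kg := ae_prod_map (act_meas g) (@act_pres g) kK.
  (* Besides invariance of [H], the agreement of [k] with the centered kernel is used both at [z]
     and at its translate. *)
  by apply: filterS3 kK kg (iH g) => z -> -> /= ->.
have [[rho0 [_ [d0 _] _ _]] d_min] := smallest_d.
have bound : opnorm2 nu k <= d%:R^-1.
  (* Without a positive norm there is no eigenspace to consider, and the bound is trivial. *)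
  have [s0|s0] := leP (opnorm2 nu k) 0; first by rewrite (le_trans s0)// invr_ge0.
  have [m [rho [phi [ms [rho_rep rho_irr rho_nt] [phi_sq phi_lin] phi_act phi_inj]]]] :=
    eigensp_degree sk k_herm k_col act_meas act_pres (@coset_act1 G K) (@coset_actM G K)
    k_inv (coset_act_ccontinuous compact_G mu_inv mu_reg (K := K))
    (coset_act_ergodic compact_G mu_inv mu_reg (K := K)) k_mean0 s0.
  have dm : (d <= m)%N.
    apply: d_min; exists rho; split => //; exists phi; split => //.
    by move=> v; exact/cL2_sqint.
  rewrite -[leRHS]mul1r ler_pdivlMr ?ltr0n//; apply: le_trans nk.
  by apply: le_trans ms; rewrite mulrC ler_pM2r// ler_nat.
apply: le_trans (cut_norm_le_opnorm sk k_herm k_col sK.1 kK) _.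
by rewrite lee_fin div1r -sqrtrV ?ler0n// ler_wsqrtr.
Qed.
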